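(* Given the exponent vectors $\alpha_1,\beta_1,\dots,\alpha_n,\beta_n\in\mathbb{N}^n$ of a system of $n$ binomials $p_j(c;x)=x^{\alpha_j}-c_jx^{\beta_j}$, $j=1,\dots,n$, in $n$ variables (with $\alpha_j\neq\beta_j$ for all $j$), one may decide in polynomial time whether $p_1,\dots,p_n$ is a generic complete intersection (gci). Moreover, if it is known that $\det B\neq 0$, where $B$ is the $n\times n$ matrix whose $j$-th row is $\alpha_j-\beta_j$, then one can check whether $p_1(c;x),\dots,p_n(c;x)$ (with $c\in(k^* )^n$) is a complete intersection in time $O(n^2)$.
   Context: $k$ is a field of characteristic zero with algebraic closure $\bar k$, and $\mathbb{N}$ includes $0$. For $c=(c_1,\dots,c_n)\in(k^* )^n$ let $\mathcal{J}_c\subset k[x_1,\dots,x_n]$ be the ideal generated by $p_1(c;x),\dots,p_n(c;x)$ and $\mathbb{V}_c\subset\bar k^n$ its zero set. The binomials $p_1(c;x),\dots,p_n(c;x)$ (or $\mathcal{J}_c$) are called a complete intersection if $\mathbb{V}_c$ is finite and non-empty. The system $p_1,\dots,p_n$ is a generic complete intersection (gci) if $\mathcal{J}_c$ is a complete intersection for generic $c$, i.e. for all $c$ in some non-empty Zariski open subset of $(k^* )^n$. Time is measured by the number of steps as a function of the number $n$ of binomials and variables. *)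

(* Defs.v *)
From mathcomp Require Import all_boot all_order all_algebra.
From mathcomp.multinomials Require Import mpoly.

Set Implicit Arguments.
Unset Strict Implicit.
Unset Printing Implicit Defensive.

Import Order.TTheory GRing.Theory Num.Theory.

Local Open Scope ring_scope.

Section Binomials.

Variables (k : fieldType) (kbar : closedFieldType) (iota : {rmorphism k -> kbar}).
Variable n : nat.
Implicit Types (a b : 'I_n -> 'X_{1..n}) (c : {ffun 'I_n -> k}).

Definition binomial a b c (j : 'I_n) : {mpoly k[n]} :=
  'X_[a j] - c j *: 'X_[b j].

Definition binomial_ideal a b c (f : {mpoly k[n]}) : Prop :=
  exists q : 'I_n -> {mpoly k[n]}, f = \sum_(j < n) q j * binomial a b c j.

Definition zero_set (I : {mpoly k[n]} -> Prop) (v : {ffun 'I_n -> kbar}) : Prop :=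
  forall f, I f -> (map_mpoly iota f).@[v] = 0.

Definition complete_intersection a b c : Prop :=
  let V := zero_set (binomial_ideal a b c) in
  (exists s : seq {ffun 'I_n -> kbar}, forall v, V v -> v \in s) /\
  (exists v, V v).

Definition torus c : Prop := forall j, c j != 0.

Definition zariski_open_in_torus (U : {ffun 'I_n -> k} -> Prop) : Prop :=
  exists F : {mpoly k[n]} -> Prop,
    forall c, U c <-> torus c /\ exists2 f, F f & f.@[c] != 0.

Definition gci a b : Prop :=
  exists U, [/\ zariski_open_in_torus U, exists c, U c
              & forall c, U c -> complete_intersection a b c].

Definition exponent_matrix a b : 'M[int]_n :=
  \matrix_(j, i) ((a j i)%:Z - (b j i)%:Z).

End Binomials.

(* Programs of a unit-cost random access machine: the memory is an array of   *)
(* integers indexed by integers, with indirect addressing (Cell).             *)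

Definition memory := int -> int.

Inductive op := OAdd | OSub | OMul | OQuo | OEq | OLt.

Definition eval_op (o : op) (x y : int) : int :=
  match o with
  | OAdd => x + y
  | OSub => x - y
  | OMul => x * y
  | OQuo => (x %/ y)%Z
  | OEq => (x == y)%R%:Z
  | OLt => (x < y)%R%:Z
  end.

Inductive expr :=
  | Const of int
  | Cell of expr
  | Op of op & expr & expr.

Fixpoint eval (m : memory) (e : expr) : int :=
  match e with
  | Const z => z
  | Cell e1 => m (eval m e1)
  | Op o e1 e2 => eval_op o (eval m e1) (eval m e2)
  end.

Fixpoint cost (e : expr) : nat :=
  match e with
  | Const _ => 1
  | Cell e1 => (cost e1).+1
  | Op _ e1 e2 => (cost e1 + cost e2).+1%N
  end.

Inductive cmd :=
  | Skip
  | Assign of expr & expr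
  | Seq of cmd & cmd
  | If of expr & cmd & cmd
  | While of expr & cmd.

Definition update (m : memory) (x v : int) : memory :=
  fun y => if y == x then v else m y.

(* [exec W p m t m']: started on memory [m], the program [p] halts after [t]  *)
(* steps with memory [m'], and every integer it assigns has at most [W] bits  *)
(* (an overflowing assignment blocks). A condition holds when its value is    *)
(* not 0. The bound matters because unit-cost arithmetic on integers of       *)
(* unrestricted length is not a reasonable measure of time. The expressions   *)
(* of a given program have bounded size, so intermediate values need no       *)
(* separate bound.                                                            *)
Inductive exec (W : nat) : cmd -> memory -> nat -> memory -> Prop :=
  | ExecSkip m :
      exec W Skip m 1 m
  | ExecAssign ea e m of (`|eval m e| < 2 ^ W)%N :
      exec W (Assign ea e) m (cost ea + cost e).+1%N
        (update m (eval m ea) (eval m e))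
  | ExecSeq p1 p2 m t1 m1 t2 m2 of
      exec W p1 m t1 m1 & exec W p2 m1 t2 m2 :
      exec W (Seq p1 p2) m (t1 + t2)%N m2
  | ExecIfTrue e p1 p2 m t m' of
      eval m e != 0 & exec W p1 m t m' :
      exec W (If e p1 p2) m (cost e + t).+1%N m'
  | ExecIfFalse e p1 p2 m t m' of
      eval m e = 0 & exec W p2 m t m' :
      exec W (If e p1 p2) m (cost e + t).+1%N m'
  | ExecWhileTrue e p m t1 m1 t2 m2 of
      eval m e != 0 & exec W p m t1 m1 & exec W (While e p) m1 t2 m2 :
      exec W (While e p) m (cost e + t1 + t2).+1%N m2
  | ExecWhileFalse e p m of
      eval m e = 0 :
      exec W (While e p) m (cost e).+1 m.

(* The answer is read off cell 0. *)
Definition decides (p : cmd) (m : memory) (T W : nat) (Q : Prop) : Prop :=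
  exists t m', [/\ exec W p m t m', (t <= T)%N & m' 0 != 0 <-> Q].

(* Cell 0 holds n, the next n ^ 2 cells the rows of the matrix (a j i), the   *)
(* next n ^ 2 cells the rows of (b j i); all the other cells hold 0.          *)
Definition input (n : nat) (a b : 'I_n -> 'X_{1..n}) : memory :=
  let entries (e : 'I_n -> 'X_{1..n}) : seq nat :=
    [seq e j i | j <- enum 'I_n, i <- enum 'I_n] in
  fun x => match x with
           | Posz y => (nth 0%N (n :: entries a ++ entries b) y)%:Z
           | Negz _ => 0
           end.

Definition max_exponent (n : nat) (a b : 'I_n -> 'X_{1..n}) : nat :=
  (\max_(j < n) \max_(i < n) maxn (a j i) (b j i))%N.

Definition bits (x : nat) : nat := (trunc_log 2 x).+1.

(* Main.v *)
(* For c in the torus, let S be the set of nonvanishing coordinates of a       *)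
(* solution v. For every j the support of a_j lies in S iff that of b_j does:  *)
(* call such S closed. Conversely the solutions with pattern S are the torus   *)
(* points of the Laurent system given by the binomials inside S (both supports *)
(* contained in S). If their exponent rows are independent, this system is     *)
(* solvable for every c, and has finitely many solutions iff there are exactly *)
(* |S| such binomials; if the rows are dependent, it is unsolvable for generic *)
(* c. Hence the system is a gci iff some closed set is independent and every   *)
(* independent closed set S is full, i.e. has |S| binomials inside.            *)
(*                                                                             *)
(* Within an independent S every T has at most |T| binomials inside, and the   *)
(* number of binomials inside is supermodular, so fullness need only be tested *)
(* on the closed sets generated by a single variable. Independence is          *)
(* tested by fraction-free (Bareiss) elimination of a Gram matrix, all of whose*)
(* intermediate values are minors, hence of polynomial bit length.             *)
(*                                                                             *)
(* If det B != 0, every closed set is independent. Passing to the complement,  *)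
(* a set I of variables is compatible if each binomial has both or none of its *)
(* supports meeting I, and one has to check that at most |I| binomials meet    *)
(* each compatible I (the opposite inequality holds for all I). If one support *)
(* of a binomial is empty, no variable of the other one belongs to a compatible*)
(* set, and it can be deleted; if the supports are distinct singletons {u} and *)
(* {v}, then u can be renamed v and the binomial dropped. Each such step takes *)
(* O(n) operations and removes a variable. When no step is possible, the       *)
(* criterion is that every remaining variable u is owned: {u} is a support of  *)
(* a remaining binomial.                                                       *)

Require Import Defs.
From mathcomp Require Import all_boot all_order all_algebra.
From mathcomp.multinomials Require Import mpoly.
From mathcomp Require Import perm zify ring.

Set Implicit Arguments.
Unset Strict Implicit.
Unset Printing Implicit Defensive.

Import Order.TTheory GRing.Theory Num.Theory.

Local Open Scope ring_scope.

(** * Structured programs *)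

(** Fix [c] in the torus and sort the solutions by the set [S] of their nonzero coordinates. On a
    closed [S] the system is a monomial map of tori, governed by linear algebra on the rows of [B]
    inside [S], with denominators cleared. Independent rows give a solution with pattern [S] by
    extracting N-th roots ([indep_solution]). If they are as many as the variables, some power of
    each coordinate is determined ([full_finite]); if fewer, a one-parameter subgroup moves a
    solution along an infinite family ([deficient_infinite]). A relation among the rows forces a
    monomial in [c] to be 1 ([dependent_relation]), which a point of a nonempty open set can be
    moved to avoid ([avoid_relation]). This yields the criteria [complete_intersection_indepP] and
    [gciP], from which [c] and the fields have disappeared.

    Both criteria range over exponentially many sets. For gci, supermodularity leaves only the
    closures of the empty set and of the singletons ([full_principal]). A closure takes at most [n]
    sweeps, and its independence is the non-vanishing of a Gram determinant ([lead_indep]), computed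
    by the exact division [bareiss_step] with intermediate values bounded by [minor_bound].

    When [det B] is nonzero, [tight_full] turns the criterion into a counting condition on a family
    of sets; [delete_step] and [merge_step] preserve it while removing a variable, and
    [stable_tight] decides it once neither applies. Storing the cardinal and the element sum of
    every set makes one removal cost O(n).

    The algorithms are written in a small language of bounded loops. A [wp] derivation gives
    correctness and absence of overflow together, [wp_exec] transfers it to the machine, and
    [time_le] bounds the time by a power of [n] whose exponent is the loop nesting depth: 4 and 2
    for the two programs. *)

Definition stride := 16%N.
(** The negative half of the memory interleaves [stride] arrays, the other half holds the input. A
    scalar is entry 0 of an array. *)
Definition loc (k i : nat) : int := Negz (k + stride * i).

Definition store := nat -> nat -> int.

(** Testing the array index before abstracting over [i'] makes [upd s k i v k'] convertible to
    [s k'] for distinct numerals, so many framing obligations close by computation. *)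
Definition upd (s : store) (k i : nat) (v : int) : store :=
  fun k' => if eqn k' k then fun i' => if i' == i then v else s k' i' else s k'.

(* Array and input indices are taken in absolute value, so that evaluation    *)
(* never leaves the half of the memory it is meant for.                       *)
Inductive sx :=
  | SC of int
  | SIn of sx
  | SA of nat & sx
  | SOp of op & sx & sx.

Fixpoint seval (inp : nat -> int) (s : store) (e : sx) : int :=
  match e with
  | SC z => z
  | SIn e1 => inp `|seval inp s e1|%N
  | SA k e1 => s k `|seval inp s e1|%N
  | SOp o e1 e2 => eval_op o (seval inp s e1) (seval inp s e2)
  end.

Definition absx (e : expr) : expr :=
  Op OMul e (Op OSub (Const 1) (Op OMul (Const 2) (Op OLt e (Const 0)))).

Definition locx (k : nat) (e : expr) : expr :=
  Op OSub (Const (Negz k)) (Op OMul (Const stride%:Z) (absx e)).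

Fixpoint compx (e : sx) : expr :=
  match e with
  | SC z => Const z
  | SIn e1 => Cell (absx (compx e1))
  | SA k e1 => Cell (locx k (compx e1))
  | SOp o e1 e2 => Op o (compx e1) (compx e2)
  end.

Fixpoint wfx (e : sx) : bool :=
  match e with
  | SC _ => true
  | SIn e1 => wfx e1
  | SA k e1 => (k < stride)%N && wfx e1
  | SOp _ e1 e2 => wfx e1 && wfx e2
  end.

(* [For k b] runs [b] with the scalar [k] ranging over [0, ..., n - 1], where *)
(* [n] is read off the input cell 0.                                          *)
Inductive prog :=
  | Done
  | Put of nat & sx & sx
  | Then of prog & prog
  | Test of sx & prog & prog
  | For of nat & prog.

Definition scell (k : nat) : expr := Cell (Const (Negz k)).

Fixpoint comp (p : prog) : cmd :=
  match p with
  | Done => Skip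
  | Put k i e => Assign (locx k (compx i)) (compx e)
  | Then p1 p2 => Seq (comp p1) (comp p2)
  | Test e p1 p2 => If (compx e) (comp p1) (comp p2)
  | For k b =>
      Seq (Assign (Const (Negz k)) (Const 0))
        (While (Op OLt (scell k) (Cell (Const 0)))
           (Seq (comp b)
              (Assign (Const (Negz k)) (Op OAdd (scell k) (Const 1)))))
  end.

Fixpoint writes (k : nat) (p : prog) : bool :=
  match p with
  | Done => false
  | Put k' _ _ => eqn k k'
  | Then p1 p2 => writes k p1 || writes k p2
  | Test _ p1 p2 => writes k p1 || writes k p2
  | For k' b => eqn k k' || writes k b
  end.

Fixpoint wf (p : prog) : bool :=
  match p with
  | Done => true
  | Put k i e => [&& (k < stride)%N, wfx i & wfx e]
  | Then p1 p2 => wf p1 && wf p2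
  | Test e p1 p2 => [&& wfx e, wf p1 & wf p2]
  | For k b => [&& (k < stride)%N, ~~ writes k b & wf b]
  end.

(** A test is charged for both branches. In a loop, 9 is the initialisation of the counter (3) plus
    the failing test (6), and 12 is a successful test (6) plus the increment (6). *)
Fixpoint time (n : nat) (p : prog) : nat :=
  match p with
  | Done => 1
  | Put k i e => (cost (locx k (compx i)) + cost (compx e)).+1
  | Then p1 p2 => time n p1 + time n p2
  | Test e p1 p2 => (cost (compx e) + (time n p1 + time n p2)).+1
  | For _ b => 9 + n * (12 + time n b)
  end.

(** The size of every assigned value is part of the precondition. Loop counters need no such clause:
    they stay at most [n], which [wp_exec] takes to be below [2 ^ W]. *)
Fixpoint wp (n W : nat) (inp : nat -> int) (p : prog) (Q : store -> Prop)
    (s : store) : Prop :=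
  match p with
  | Done => Q s
  | Put k i e => (`|seval inp s e| < 2 ^ W)%N /\
      Q (upd s k `|seval inp s i|%N (seval inp s e))
  | Then p1 p2 => wp n W inp p1 (wp n W inp p2 Q) s
  | Test e p1 p2 => if seval inp s e != 0 then wp n W inp p1 Q s
                    else wp n W inp p2 Q s
  | For k b => exists Inv : nat -> store -> Prop,
      [/\ Inv 0%N (upd s k 0%N 0),
          forall i s', (i < n)%N -> Inv i s' -> s' k 0%N = i%:Z ->
            wp n W inp b (fun s2 => Inv i.+1 (upd s2 k 0%N i.+1%:Z)) s'
        & forall s', Inv n s' -> Q s']
  end.

Lemma wp_mono n W inp p (Q Q' : store -> Prop) s :
  (forall s', Q s' -> Q' s') -> wp n W inp p Q s -> wp n W inp p Q' s.
Proof.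
elim: p Q Q' s => [|k i e|p1 IH1 p2 IH2|e p1 IH1 p2 IH2|k b IH] Q Q' s QQ' /=.
- exact: QQ'.
- by case=> ? /QQ'.
- by apply: IH1 => s'; apply: IH2.
- by case: ifP => _; [apply: IH1|apply: IH2].
- by case=> Inv [I0 IS In]; exists Inv; split=> // s' /In /QQ'.
Qed.

Lemma updk s k i v : upd s k i v k = fun i' => if i' == i then v else s k i'.
Proof. by rewrite /upd -[eqn k k]/(k == k) eqxx. Qed.

Lemma upd_neq s k i v k' : eqn k' k = false -> upd s k i v k' = s k'.
Proof. by rewrite /upd => ->. Qed.

(** Frame rule: each loop invariant is strengthened by equality on the unwritten arrays. *)
Lemma wp_frame n W inp p (Q : store -> Prop) s :
  wp n W inp p Q s ->
  wp n W inp p (fun s' => Q s' /\ forall k, ~~ writes k p -> s' k = s k) s.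
Proof.
elim: p Q s => [|k i e|p1 IH1 p2 IH2|e p1 IH1 p2 IH2|k b IH] Q s /=.
- by split.
- by case=> ? ?; do 2?split=> //; move=> k' /negbTE; apply: upd_neq.
- move/IH1; apply: wp_mono => s1 [/IH2 + F1]; apply: wp_mono => s2 [? F2].
  by split=> // k; rewrite negb_or => /andP[k1 k2]; rewrite F2 // F1.
- by case: ifP => _ => [/IH1|/IH2]; apply: wp_mono => s' [? F]; split=> // k;
     rewrite negb_or => /andP[k1 k2]; rewrite F.
case=> Inv [I0 IS In].
exists (fun i s' => Inv i s' /\
  forall k', ~~ (eqn k' k || writes k' b) -> s' k' = s k').
split.
- split=> // k'; rewrite negb_or => /andP[/negbTE k'k _]; exact: upd_neq.
- move=> i s' ltin [Is' F] s'k.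
  move/(_ i s' ltin Is' s'k): IS => /IH; apply: wp_mono => s2 [I2 F2].
  split=> // k' H; have:= H; rewrite negb_or => /andP[/negbTE k'k k'b].
  by rewrite upd_neq // F2 // F.
- by move=> s' [? ?]; split=> //; exact: In.
Qed.

Definition rep (inp : nat -> int) (m : memory) (s : store) : Prop :=
  (forall k i, (k < stride)%N -> m (loc k i) = s k i) /\
  (forall y : nat, m (Posz y) = inp y).

Lemma loc_inj k i k' i' : (k < stride)%N -> (k' < stride)%N ->
  (loc k i == loc k' i') = (k == k') && (i == i').
Proof.
rewrite /loc /stride => ltk ltk'.
apply/eqP/andP=> [[E]|[/eqP-> /eqP->]//].
have [-> ->] : k = k' /\ i = i' by lia.
by rewrite !eqxx.
Qed.

Lemma rep_update inp m s k i v : (k < stride)%N ->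
  rep inp m s -> rep inp (update m (loc k i) v) (upd s k i v).
Proof.
move=> ltk [Hs Hi]; split=> [k' i' ltk'|y]; rewrite /update; last exact: Hi.
rewrite loc_inj // /upd -[eqn k' k]/(k' == k).
by case: eqP => [->|_]; case: (i' =P i) => [->|_] //=; exact: Hs.
Qed.

Lemma eval_absx m e : eval m (absx e) = `|eval m e|%N.
Proof.
rewrite /absx /=; set x := eval m e; rewrite abszE.
case: ltrP => x0 /=; last by rewrite ger0_norm // mulr0 subr0 mulr1.
by rewrite ltr0_norm // mulr1 -[1 - 2]/(-1 : int) mulrN1.
Qed.

Lemma eval_locx m k e : eval m (locx k e) = loc k `|eval m e|%N.
Proof.
rewrite /locx -[LHS]/(Negz k - stride%:Z * eval m (absx e)) eval_absx.
rewrite /loc; lia.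
Qed.

Lemma eval_compx inp m s e : rep inp m s -> wfx e ->
  eval m (compx e) = seval inp s e.
Proof.
move=> [Hs Hi]; elim: e => [z|e IH|k e IH|o e1 IH1 e2 IH2] //.
- by move/IH=> E; rewrite -[LHS]/(m (eval m (absx (compx e)))) eval_absx E Hi.
- move=> /andP[ltk /IH E].
  by rewrite -[LHS]/(m (eval m (locx k (compx e)))) eval_locx E Hs.
- by move=> /andP[/IH1 E1 /IH2 E2] /=; rewrite E1 E2.
Qed.

(** Simulation of the store by the memory. A loop is handled by induction on the number [d] of
    remaining rounds; the frame rule shows that the body leaves the counter alone. *)
Lemma wp_exec n W inp p (Q : store -> Prop) m s :
  inp 0%N = n%:Z -> (n < 2 ^ W)%N -> wf p -> rep inp m s -> wp n W inp p Q s ->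
  exists t m' s', [/\ exec W (comp p) m t m', (t <= time n p)%N,
                      rep inp m' s' & Q s'].
Proof.
move=> inp0 ltnW.
elim: p Q m s => [|k i e|p1 IH1 p2 IH2|e p1 IH1 p2 IH2|k b IH] Q m s.
- by move=> _ r q; exists 1%N, m, s; split=> //; constructor.
- move=> /and3P[ltk wi we] r [lte q].
  exists (time n (Put k i e)), (update m (loc k `|seval inp s i|%N) (seval inp s e)).
  exists (upd s k `|seval inp s i|%N (seval inp s e)); split=> //.
    rewrite -(eval_compx r we) -(eval_compx r wi) -eval_locx.
    by constructor; rewrite (eval_compx r we).
  exact: rep_update.
- move=> /andP[w1 w2] r /(IH1 _ _ _ w1 r) [t1 [m1 [s1 [e1 l1 r1 q1]]]].
  have [t2 [m2 [s2 [e2 l2 r2 q2]]]] := IH2 _ _ _ w2 r1 q1.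
  exists (t1 + t2)%N, m2, s2; split=> //; last exact: leq_add.
  exact: ExecSeq e1 e2.
- move=> /and3P[we w1 w2] r /=; rewrite -(eval_compx r we).
  case: ifPn => [ne0 /(IH1 _ _ _ w1 r)|/negPn/eqP eq0 /(IH2 _ _ _ w2 r)] [t [m' [s' [ex le r' q]]]].
    exists (cost (compx e) + t).+1, m', s'; split=> //; last lia.
    exact: ExecIfTrue.
  exists (cost (compx e) + t).+1, m', s'; split=> //; last lia.
  exact: ExecIfFalse.
move=> /and3P[ltk nwk wb] r [Inv [I0 IS In]].
pose cond := Op OLt (scell k) (Cell (Const 0)).
pose step := Assign (Const (Negz k)) (Op OAdd (scell k) (Const 1)).
have lock0 : Negz k = loc k 0 by rewrite /loc muln0 addn0.
have loop d : forall i m1 s1, (i + d = n)%N -> rep inp m1 s1 -> Inv i s1 ->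
    s1 k 0%N = i%:Z ->
    exists t m' s', [/\ exec W (While cond (Seq (comp b) step)) m1 t m',
      (t <= 6 + d * (12 + time n b))%N, rep inp m' s' & Q s'].
  elim: d => [|d IHd] i m1 s1 idn r1 Ii s1k.
    rewrite addn0 in idn; subst i; exists 6%N, m1, s1; split=> //; last exact: In.
    apply: (@ExecWhileFalse W cond) => /=.
    by case: r1 => rs ri; rewrite lock0 rs // s1k ri inp0 ltxx.
  have ltin : (i < n)%N by lia.
  have := IS _ _ ltin Ii s1k => /wp_frame/(IH _ _ _ wb r1).
  case=> [t [m2 [s2 [ex2 le2 r2 [I2 F2]]]]].
  have s2k : s2 k 0%N = i by rewrite F2.
  have [t' [m' [s' [ex' le' r' q']]]] :=
    IHd i.+1 (update m2 (loc k 0) i.+1%:Z) (upd s2 k 0 i.+1%:Z)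
      ltac:(lia) (rep_update _ _ ltk r2) I2 ltac:(by rewrite updk).
  exists (5 + (t + 6) + t').+1%N, m', s'; split=> //; last lia.
  have condT : eval m1 cond != 0.
    case: r1 => rs ri; rewrite /= lock0 rs // s1k ri inp0.
    by rewrite ltz_nat ltin.
  apply: (@ExecWhileTrue W cond _ _ (t + 6)%N _ _ _ condT _ ex').
  apply: ExecSeq ex2 _.
  have stepE : eval m2 (Op OAdd (scell k) (Const 1)) = i.+1%:Z.
    by case: r2 => rs _; rewrite /= lock0 rs // s2k; lia.
  have : exec W step m2 6 (update m2 (eval m2 (Const (Negz k)))
           (eval m2 (Op OAdd (scell k) (Const 1)))).
    constructor; rewrite stepE absz_nat; exact: leq_ltn_trans ltnW.
  by rewrite stepE /= lock0.
have [t [m' [s' [ex le r' q]]]] :=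
  loop n 0%N _ _ (add0n n) (rep_update 0%N 0 ltk r) I0 ltac:(by rewrite updk).
exists (3 + t)%N, m', s'; split=> //.
apply: (@ExecSeq _ _ _ _ 3 (update m (loc k 0) 0) _ _ _ ex).
rewrite -lock0; apply: (@ExecAssign W (Const (Negz k)) (Const 0) m).
by rewrite /= expn_gt0.
Qed.

(** * Minors and fraction-free elimination *)

Section Minors.

Variable R : comNzRingType.
Implicit Type f : nat -> nat -> R.

Definition ndet m f : R := \det (\matrix_(s < m, t < m) f s t).

Definition lead f k : R := ndet k f.

(** The leading block of order [k] bordered by row [i] and column [j]: an entry of level [k] of
    fraction-free elimination. *)
Definition minor f k i j : R :=
  ndet k.+1 (fun s t => f (if (s < k)%N then s else i)
                          (if (t < k)%N then t else j)).

Lemma eq_ndet m f g : (forall s t, (s < m)%N -> (t < m)%N -> f s t = g s t) ->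
  ndet m f = ndet m g.
Proof. by move=> fg; congr determinant; apply/matrixP=> s t; rewrite !mxE fg. Qed.

Lemma lead0 f : lead f 0 = 1. Proof. exact: det_mx00. Qed.

Lemma minor0 f i j : minor f 0 i j = f i j.
Proof. by rewrite /minor /ndet det_mx11 mxE. Qed.

Lemma minor_lead f k : minor f k k k = lead f k.+1.
Proof.
have E s : (s < k.+1)%N -> (if (s < k)%N then s else k) = s.
  by rewrite ltnS leq_eqVlt; case: eqP => [->|_ /= ->] //; rewrite if_same.
by apply: eq_ndet => s t lts ltt; rewrite !E.
Qed.

Lemma ndet_block k p f :
  ndet (k + p) f =
  \det (block_mx (\matrix_(s < k, t < k) f s t) (\matrix_(s < k, t < p) f s (k + t)%N)
    (\matrix_(s < p, t < k) f (k + s)%N t)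
    (\matrix_(s < p, t < p) f (k + s)%N (k + t)%N)).
Proof.
congr determinant.
by apply/matrixP=> s t; rewrite !mxE; case: splitP => s' ->; rewrite !mxE;
   case: splitP => t' ->; rewrite !mxE.
Qed.

End Minors.

Lemma det_schur (F : fieldType) k p (P : 'M[F]_k) (U : 'M_(k, p)) V W :
  P \in unitmx ->
  \det (block_mx P U V W) = \det P * \det (W - V *m invmx P *m U).
Proof.
move=> uP; rewrite -(det_ublock _ U).
have -> : block_mx P U 0 (W - V *m invmx P *m U) =
    block_mx 1%:M 0 (- (V *m invmx P)) 1%:M *m block_mx P U V W.
  by rewrite mulmx_block !mul1mx !mul0mx !addr0 !mulNmx mulmxKV // addNr addrC.
by rewrite det_mulmx det_lblock !det1 !mul1r.
Qed.

(** * Sylvester's identity for bordered minors *)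

Section Sylvester.

Variables (F : fieldType) (f : nat -> nat -> F) (k : nat).

Let P := \matrix_(s < k, t < k) f s t.
Let compl i j : F :=
  f i j - \sum_(t < k) (\sum_(s < k) f i s * invmx P s t) * f t j.

Lemma minor_compl i j : lead f k != 0 -> minor f k i j = lead f k * compl i j.
Proof.
move=> D0; have uP : P \in unitmx by rewrite unitmxE unitfE.
rewrite /minor -addn1 ndet_block.
set P' := (X in block_mx X); have -> : P' = P.
  by apply/matrixP=> s t; rewrite !mxE !ltn_ord.
rewrite det_schur // det_mx11 !mxE !addn0 ltnn; congr (_ * (_ - _)).
apply: eq_bigr => t _; rewrite !mxE addn0 ltnn ltn_ord; congr (_ * _).
by apply: eq_bigr => s _; rewrite !mxE addn0 ltnn ltn_ord.
Qed.

(** Bordering the leading block twice gives its determinant times a 2 by 2 determinant of Schur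
    complement entries [compl]; bordering it once gives its determinant times a single entry
    ([minor_compl]). *)
Lemma sylvester i j : lead f k != 0 ->
  lead f k * minor f k.+1 i j =
  minor f k k k * minor f k i j - minor f k i k * minor f k k j.
Proof.
move=> D0; have uP : P \in unitmx by rewrite unitmxE unitfE.
rewrite !minor_compl //.
have ltk (s : 'I_k) : (s < k.+1)%N by apply: ltnW; rewrite ltnS.
have -> : minor f k.+1 i j =
    lead f k * (compl k k * compl i j - compl i k * compl k j).
  rewrite /minor -addn2 ndet_block.
  set P' := (X in block_mx X); have -> : P' = P.
    by apply/matrixP=> s t; rewrite !mxE !ltk.
  rewrite det_schur //; congr (_ * _).
  set M := (X in \det X).
  have E (a b : 'I_2) : M a b = compl (if a == 0 then k else i) (if b == 0 then k else j).
    rewrite !mxE; congr (_ - _).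
      by case: a b => [[|[|//]] ?] [[|[|//]] ?] /=; rewrite ?addn0 ?addn1 ?ltnS ?leqnn ?ltnn.
    apply: eq_bigr => t _; rewrite !mxE; congr (_ * _).
      apply: eq_bigr => s _; rewrite !mxE ltk.
      by case: a => [[|[|//]] ?] /=; rewrite ?addn0 ?addn1 ?ltnS ?leqnn ?ltnn.
    rewrite ltk.
    by case: b => [[|[|//]] ?] /=; rewrite ?addn0 ?addn1 ?ltnS ?leqnn ?ltnn.
  rewrite (expand_det_row _ 0) big_ord_recl big_ord1 /cofactor !det_mx11.
  have N (a b : 'I_2) : (row' a (col' b M)) 0 0 = M (lift a 0) (lift b 0).
    by rewrite mxE [LHS]mxE.
  by rewrite !N !E /= !expr0 expr1; ring.
by rewrite /lead; ring.
Qed.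

End Sylvester.

Lemma mulmx_tr_eq0 (F : realFieldType) p (u : 'rV[F]_p) : u *m u^T = 0 -> u = 0.
Proof.
move/matrixP/(_ 0 0); rewrite !mxE => /eqP.
rewrite psumr_eq0 => [/allP u0|i _]; last by rewrite mxE -expr2 sqr_ge0.
apply/rowP=> i; have := u0 i (mem_index_enum i).
by rewrite !mxE -expr2 sqrf_eq0 => /eqP.
Qed.

Lemma ndet_intr (F : comNzRingType) m (f : nat -> nat -> int) :
  (ndet m f)%:~R = ndet m (fun s t => (f s t)%:~R) :> F.
Proof. by rewrite -det_map_mx; congr determinant; apply/matrixP=> s t; rewrite !mxE. Qed.

Lemma minor_intr (F : comNzRingType) (f : nat -> nat -> int) k i j :
  (minor f k i j)%:~R = minor (fun s t => (f s t)%:~R) k i j :> F.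
Proof. exact: ndet_intr. Qed.

(** * Gram determinants and exact division *)

Section Gram.

Variables (p : nat) (X : nat -> nat -> int).

Definition gram (j l : nat) : int := \sum_(c < p) X j c * X l c.

Let Xq k : 'M[rat]_(k, p) := \matrix_(s < k, c < p) (X s c)%:~R.

Lemma lead_gram k : (lead gram k)%:~R = \det (Xq k *m (Xq k)^T).
Proof.
rewrite /lead ndet_intr; congr determinant; apply/matrixP=> s t; rewrite !mxE.
by rewrite rmorph_sum; apply: eq_bigr => c _; rewrite rmorphM !mxE.
Qed.

(** A vector killed by the Gram matrix is already a relation among the rows, since a vanishing sum
    of squares has only zero terms ([mulmx_tr_eq0]). *)
Lemma lead_gram_eq0P k :
  (exists2 v : 'rV[rat]_k, v != 0 & v *m Xq k = 0) <-> lead gram k = 0.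
Proof.
have -> : (lead gram k = 0) <-> (\det (Xq k *m (Xq k)^T) == 0).
  by rewrite -lead_gram intr_eq0; split=> /eqP.
split=> [[v v0 vX]|/det0P[v v0 vX]].
  by apply/det0P; exists v; rewrite // mulmxA vX mul0mx.
exists v => //; apply: mulmx_tr_eq0.
by rewrite trmx_mul mulmxA -(mulmxA v) vX mul0mx.
Qed.

(** A relation among the first [k] rows, extended by zeros, remains a relation among the rows of
    every later bordered minor. *)
Lemma minor_gram_eq0 k k' i j : (k <= k')%N -> lead gram k = 0 ->
  minor gram k' i j = 0.
Proof.
move=> lekk' /lead_gram_eq0P[v v0 vX].
apply/eqP; rewrite -(intr_eq0 rat) ndet_intr; apply/det0P.
have lek : (k <= k'.+1)%N by exact: leqW.
exists (\row_(s < k'.+1) if insub (val s) is Some s' then v 0 s' else 0).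
  apply: contraNneq v0 => /rowP E; apply/eqP/rowP=> s.
  have := E (widen_ord lek s); rewrite !mxE /= => <-.
  by rewrite insubT //= => ?; congr (v 0 _); apply: val_inj.
apply/rowP=> t; rewrite !mxE.
under eq_bigr => s _ do rewrite !mxE rmorph_sum mulr_sumr.
rewrite exchange_big big1 //= => c _.
under eq_bigr => s _ do rewrite rmorphM mulrA.
rewrite -mulr_suml.
suff -> : \sum_(s < k'.+1) (if insub (val s) is Some s' then v 0 s' else 0) *
    (X (if (s < k')%N then val s else i) c)%:~R = (v *m Xq k) 0 c :> rat.
  by rewrite vX mxE mul0r.
rewrite mxE (bigID (fun s : 'I_k'.+1 => (s < k)%N)) /= addrC big1 => [|s]; last first.
  by move=> ?; rewrite insubF ?mul0r //; apply/negbTE.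
rewrite add0r (big_ord_narrow lek); apply: eq_bigr => s _; rewrite mxE /=.
rewrite (leq_trans (ltn_ord s)) //; congr (_ * _).
by rewrite insubT //= => ?; congr (v 0 _); apply: val_inj.
Qed.

(* A vanishing pivot forces the later minors to vanish as well, and indeed    *)
(* division by 0 returns 0, so no pivoting or test is needed.                 *)
Lemma bareiss_step k i j :
  minor gram k.+1 i j =
  ((minor gram k k k * minor gram k i j - minor gram k i k * minor gram k k j)
    %/ lead gram k)%Z.
Proof.
have [D0|D0] := eqVneq (lead gram k) 0.
  by rewrite D0 divz0 (minor_gram_eq0 _ _ (leqnSn k)).
suff -> : minor gram k k k * minor gram k i j - minor gram k i k * minor gram k k j =
    minor gram k.+1 i j * lead gram k by rewrite mulzK.
apply/eqP; rewrite -(eqr_int rat) rmorphB !rmorphM /= !minor_intr [X in _ == X]mulrC.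
rewrite /lead ndet_intr; apply/eqP/esym/sylvester.
by rewrite /lead -ndet_intr intr_eq0.
Qed.

End Gram.

(** Leibniz expansion: [m!] signed products of [m] entries. *)
Lemma ndet_bound m (f : nat -> nat -> int) (B : nat) :
  (forall s t, (s < m)%N -> (t < m)%N -> (`|f s t| <= B)%N) ->
  (`|ndet m f| <= m`! * B ^ m)%N.
Proof.
move=> fB; rewrite -lez_nat abszE.
apply: (@le_trans _ _ (\sum_(s : 'S_m) (B ^ m)%:Z)).
  apply: le_trans (ler_norm_sum _ _ _) (ler_sum _ _) => s _.
  rewrite normrM normrX normrN1 expr1n mul1r normr_prod.
  have -> : (B ^ m)%:Z = \prod_(i < m) B%:Z.
    by rewrite prodr_const card_ord; lia.
  apply: ler_prod => i _; rewrite normr_ge0 mxE -abszE lez_nat fB //.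
by rewrite sumr_const card_Sn -mulr_natr natz mulrC.
Qed.

(** * Closed sets of variables and independence of exponents *)

Section Patterns.

Variable n : nat.
Implicit Types (e : 'X_{1..n}) (S T : {set 'I_n}).

Definition supp e : {set 'I_n} := [set i | e i != 0%N].

Variables a b : 'I_n -> 'X_{1..n}.

(* [S] stands for the set of nonvanishing coordinates of a solution. *)
Definition closed S : bool :=
  [forall j, (supp (a j) \subset S) == (supp (b j) \subset S)].

Definition inside S : {set 'I_n} :=
  [set j | (supp (a j) \subset S) && (supp (b j) \subset S)].

Definition dexp (j i : 'I_n) : int := (a j i)%:Z - (b j i)%:Z.

Definition Brat : 'M[rat]_n := map_mx intr (exponent_matrix a b).

Definition Brows S : 'M[rat]_(#|inside S|, n) := rowsub (@enum_val _ (mem (inside S))) Brat.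

Definition indep S : bool := row_free (Brows S).

Definition Erows S : 'M[rat]_(#|S|, n) := rowsub (@enum_val _ (mem S)) 1%:M.

Lemma BratE j i : Brat j i = (dexp j i)%:~R. Proof. by rewrite !mxE. Qed.

Lemma closedP S :
  reflect (forall j, (supp (a j) \subset S) = (supp (b j) \subset S)) (closed S).
Proof. exact: 'forall_eqP. Qed.

Lemma inside_closed S j : closed S -> (j \in inside S) = (supp (a j) \subset S).
Proof. by rewrite inE => /closedP <-; rewrite andbb. Qed.

Lemma insideS S T : S \subset T -> inside S \subset inside T.
Proof.
move=> sST; apply/subsetP=> j; rewrite !inE => /andP[sa sb].
by rewrite !(subset_trans _ sST).
Qed.

Lemma suppN S e i : supp e \subset S -> i \notin S -> e i = 0%N.
Proof.
by move=> /subsetP sS; apply: contraNeq => ei; apply: sS; rewrite inE.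
Qed.

Lemma dexp_inside S j i : j \in inside S -> i \notin S -> dexp j i = 0.
Proof.
by rewrite inE /dexp => /andP[sa sb] iS; rewrite (suppN sa iS) (suppN sb iS).
Qed.

Lemma sum_enum_val (R : nmodType) (A : {set 'I_n}) (F : 'I_n -> R) :
  (forall j, j \notin A -> F j = 0) ->
  \sum_(s < #|A|) F (enum_val s) = \sum_j F j.
Proof.
move=> F0; rewrite [RHS](bigID (fun j => j \in A)) /= [X in _ = _ + X]big1 // addr0.
by rewrite [RHS]big_enum_val.
Qed.

(** Vectors indexed by all binomials and vanishing off [inside S] replace the enumeration of rows,
    which makes monotonicity ([indepS]) immediate. *)
Lemma indepP S : reflect
  (forall w : 'rV[rat]_n, (forall j, j \notin inside S -> w 0 j = 0) ->
    w *m Brat = 0 -> w = 0)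
  (indep S).
Proof.
have mulE (w : 'rV[rat]_n) : (forall j, j \notin inside S -> w 0 j = 0) ->
    w *m Brat = colsub (@enum_val _ (mem (inside S))) w *m Brows S.
  move=> w0; apply/rowP=> i; rewrite !mxE -(sum_enum_val (A := inside S)).
    by apply: eq_bigr => s _; rewrite !mxE.
  by move=> j /w0 ->; rewrite mul0r.
apply: (iffP idP) => [fr w w0 wB|H].
  have /(row_free_inj fr) E : colsub (@enum_val _ (mem (inside S))) w *m Brows S = 0 *m Brows S.
    by rewrite mul0mx -mulE.
  apply/rowP=> j; rewrite mxE; have [jS|/w0//] := boolP (j \in inside S).
  by have /rowP/(_ (enum_rank_in jS j)) := E; rewrite !mxE enum_rankK_in.
apply: inj_row_free => v vB.
pose w : 'rV[rat]_n := \row_j \sum_(s < #|inside S|) v 0 s * (enum_val s == j)%:R.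
have wv s : w 0 (enum_val s) = v 0 s.
  rewrite mxE (bigD1 s) //= eqxx mulr1 big1 ?addr0 // => t ts.
  by rewrite (inj_eq enum_val_inj) (negbTE ts) mulr0.
have w0 j : j \notin inside S -> w 0 j = 0.
  move=> jS; rewrite mxE big1 // => s _; case: eqP => [E|_]; last by rewrite mulr0.
  by rewrite -E enum_valP in jS.
have : w = 0.
  apply: H => //; rewrite mulE // -[RHS]vB; congr (_ *m _).
  by apply/rowP=> s; rewrite mxE wv.
by move=> E; apply/rowP=> s; rewrite -wv E !mxE.
Qed.

Lemma indepS S T : inside S \subset inside T -> indep T -> indep S.
Proof.
move=> sST /indepP iT; apply/indepP=> w w0; apply: iT => j jT; apply: w0.
by apply: contra jT; apply: subsetP.
Qed.

Lemma Brows_sub S : (Brows S <= Erows S)%MS.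
Proof.
apply/submxP; exists (colsub (@enum_val _ (mem S)) (Brows S)).
apply/matrixP=> s i; rewrite mxE [RHS]mxE.
pose F t := Brat (enum_val s) t * (t == i)%:R.
have F0 t : t \notin S -> F t = 0.
  by move=> tS; rewrite /F BratE (dexp_inside (enum_valP s) tS) mul0r.
transitivity (\sum_t F t).
  by rewrite (bigD1 i) //= /F eqxx mulr1 big1 ?addr0 // => t /negbTE->; rewrite mulr0.
rewrite -(sum_enum_val F0); apply: eq_bigr => t _; rewrite /F.
by congr (_ * _); rewrite [RHS]mxE ?mxE.
Qed.

Lemma rank_Erows S : (\rank (Erows S) <= #|S|)%N.
Proof. exact: rank_leq_row. Qed.

(** The rows inside [T] lie in the span of the unit vectors of [T], whose rank is at most [#|T|]. *)
Lemma indep_card S T : indep S -> T \subset S -> (#|inside T| <= #|T|)%N.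
Proof.
move=> iS sTS; have : indep T by exact: indepS (insideS sTS) iS.
move/eqP <-; exact: leq_trans (mxrankS (Brows_sub T)) (rank_Erows T).
Qed.

Lemma clear_denominators (T : finType) (f : T -> rat) :
  exists2 N : nat, (0 < N)%N & exists g : T -> int, forall t, f t * N%:R = (g t)%:~R.
Proof.
exists (\prod_t `|denq (f t)|%N); first by rewrite prodn_gt0 // => t; rewrite absz_gt0 denq_neq0.
exists (fun t => numq (f t) * (\prod_(u | u != t) `|denq (f u)|)%N%:Z) => t.
rewrite (bigD1 t) //= natrM intrM mulrA; congr (_ * _).
rewrite -{1}[f t]divq_num_den -[_%:R]/(`|denq (f t)|%N%:Z%:~R) absz_denq.
by rewrite divfK // intr_eq0 denq_neq0.
Qed.

(** A right inverse of the independent rows, scaled to be integral; [r] provides the exponents of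
    the explicit solution in [indep_solution]. *)
Lemma indep_solve S : indep S ->
  exists2 N : nat, (0 < N)%N & exists r : 'I_n -> 'I_n -> int,
  forall j l, j \in inside S -> l \in inside S ->
    \sum_i dexp j i * r i l = N%:Z * (j == l)%:R.
Proof.
move/row_freeP=> [R BR].
have [N N0 [g gE]] := clear_denominators (fun x => R x.1 x.2).
exists N => //; case: (set_0Vmem (inside S)) => [->|[l0 l0S]].
  by exists (fun _ _ => 0) => j l; rewrite inE.
exists (fun i l => g (i, enum_rank_in l0S l)) => j l jS lS.
apply/eqP; rewrite -(eqr_int rat) rmorph_sum rmorphM /=; apply/eqP.
under eq_bigr => i _ do rewrite rmorphM /= -gE mulrA.
rewrite -mulr_suml mulrC [RHS]mulrC [LHS]mulrC; congr (_ * _).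
have /matrixP/(_ (enum_rank_in l0S j) (enum_rank_in l0S l)) := BR.
rewrite !mxE (inj_in_eq (can_in_inj (enum_rankK_in l0S))) // => E.
rewrite rmorph_nat -E; apply: eq_bigr => i _.
by rewrite !mxE enum_rankK_in.
Qed.

(** By dimension the rows span the whole coordinate space of [S], so a multiple of each unit vector
    is an integral combination of them. *)
Lemma full_span S i : indep S -> #|inside S| = #|S| -> i \in S ->
  exists2 N : nat, (0 < N)%N & exists m : 'I_n -> int,
  forall i', \sum_(j in inside S) m j * dexp j i' = N%:Z * (i == i')%:R.
Proof.
move=> iS cS i_S.
have : (Erows S <= Brows S)%MS.
  rewrite -(mxrank_leqif_sup (Brows_sub S)) eqn_leq mxrankS ?Brows_sub //=.
  by rewrite (eqP iS) cS rank_Erows.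
move/submxP=> [D DE].
pose s := enum_rank_in i_S i.
have [N N0 [g gE]] := clear_denominators (fun t => D s t).
exists N => //; case: (set_0Vmem (inside S)) => [J0|[l0 l0S]].
  by have := cS; rewrite J0 cards0 (cardD1 i) i_S.
exists (fun j => g (enum_rank_in l0S j)) => i'.
apply/eqP; rewrite -(eqr_int rat) rmorph_sum rmorphM /=; apply/eqP.
rewrite big_enum_val /=.
under eq_bigr => t _ do rewrite rmorphM /= enum_valK_in -gE mulrAC.
rewrite -mulr_suml [RHS]mulrC; congr (_ * _).
have /matrixP/(_ s i') := DE; rewrite !mxE enum_rankK_in // rmorph_nat => ->.
by apply: eq_bigr => t _; rewrite !mxE.
Qed.

(** Fewer rows than columns leave a kernel; [w] is the direction of the family in
    [deficient_infinite]. *)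
Lemma deficient_kernel S : (#|inside S| < #|S|)%N ->
  exists w : 'I_n -> int, [/\ exists i, w i != 0,
    forall i, i \notin S -> w i = 0
  & forall j, j \in inside S -> \sum_i dexp j i * w i = 0].
Proof.
move=> ltS; pose C := (colsub (@enum_val _ (mem S)) (Brows S))^T.
have : kermx C != 0.
  rewrite kermx_eq0 /row_free neq_ltn (leq_ltn_trans (rank_leq_col _)) //.
move/rowV0Pn=> [v /sub_kermxP vC /rV0Pn[s0 vs0]].
have [N N0 [g gE]] := clear_denominators (fun t => v 0 t).
have g0 t : (g t == 0) = (v 0 t == 0).
  by rewrite -(intr_eq0 rat) -gE mulf_eq0 pnatr_eq0 -leqn0 leqNgt N0 orbF.
case: (set_0Vmem S) => [S0|[l0 l0S]]; first by rewrite S0 cards0 in ltS.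
exists (fun i => if i \in S then g (enum_rank_in l0S i) else 0); split.
- by exists (enum_val s0); rewrite enum_valP enum_valK_in g0.
- by move=> i /negbTE->.
move=> j jS; apply/eqP; rewrite -(intr_eq0 rat) rmorph_sum /=.
rewrite -(sum_enum_val (A := S)); last by move=> i /negbTE ->; rewrite mulr0.
under eq_bigr => t _ do rewrite enum_valP enum_valK_in rmorphM /= -gE mulrA.
rewrite -mulr_suml mulf_eq0; apply/orP; left; apply/eqP.
have E : (v *m C) 0 (enum_rank_in jS j) = 0 by rewrite vC mxE.
by rewrite -[RHS]E [RHS]mxE; apply: eq_bigr => t _; rewrite !mxE enum_rankK_in // mulrC.
Qed.

Lemma dep_relation S : ~~ indep S ->
  exists m : 'I_n -> int, [/\ exists j, m j != 0,
    forall j, j \notin inside S -> m j = 0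
  & forall i, \sum_j m j * dexp j i = 0].
Proof.
move=> dS.
have : kermx (Brows S) != 0 by rewrite kermx_eq0.
move/rowV0Pn=> [v /sub_kermxP vB /rV0Pn[s0 vs0]].
have [N N0 [g gE]] := clear_denominators (fun t => v 0 t).
have g0 t : (g t == 0) = (v 0 t == 0).
  by rewrite -(intr_eq0 rat) -gE mulf_eq0 pnatr_eq0 -leqn0 leqNgt N0 orbF.
have l0S := enum_valP s0; set l0 := enum_val s0 in l0S.
exists (fun j => if j \in inside S then g (enum_rank_in l0S j) else 0); split.
- by exists (enum_val s0); rewrite enum_valP enum_valK_in g0.
- by move=> j /negbTE->.
move=> i; apply/eqP; rewrite -(intr_eq0 rat) rmorph_sum /=.
rewrite -(sum_enum_val (A := inside S)); last by move=> j /negbTE ->; rewrite mul0r.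
under eq_bigr => t _ do rewrite enum_valP enum_valK_in rmorphM /= -gE mulrAC.
rewrite -mulr_suml mulf_eq0; apply/orP; left; apply/eqP.
have E : (v *m Brows S) 0 i = 0 by rewrite vB mxE.
by rewrite -[RHS]E [RHS]mxE; apply: eq_bigr => t _; rewrite !mxE.
Qed.

End Patterns.

(** * Laurent monomials *)

Section LaurentMonomials.

Variables (K : fieldType) (n : nat).
Implicit Types (x : 'I_n -> K) (e : 'I_n -> int).

Definition lmono x e : K := \prod_i x i ^ e i.

Lemma eq_lmono x x' e e' : (forall i, x i ^ e i = x' i ^ e' i) ->
  lmono x e = lmono x' e'.
Proof. by move=> E; apply: eq_bigr. Qed.

Lemma exprz_sum (z : K) (I : finType) (P : pred I) (f : I -> int) : z != 0 ->
  z ^ (\sum_(j | P j) f j) = \prod_(j | P j) z ^ f j.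
Proof. by move=> z0; apply: big_morph => // i j; rewrite expfzDr. Qed.

Lemma prodrXz (I : finType) (P : pred I) (f : I -> K) (z : int) :
  (\prod_(j | P j) f j) ^ z = \prod_(j | P j) f j ^ z.
Proof. by apply: (big_morph (fun y => y ^ z)) => [u v|]; rewrite ?exp1rz // expfzMl. Qed.

Lemma lmono_sum x (I : finType) (P : pred I) (m : I -> int) (e : I -> 'I_n -> int) :
  (forall i, x i != 0) ->
  lmono x (fun i => \sum_(j | P j) m j * e j i) = \prod_(j | P j) lmono x (e j) ^ m j.
Proof.
move=> x0; rewrite /lmono.
under eq_bigr => i _ do rewrite exprz_sum //.
rewrite exchange_big; apply: eq_bigr => j _.
by rewrite prodrXz; apply: eq_bigr => i _; rewrite mulrC exprz_exp.
Qed.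

End LaurentMonomials.

(** * Infinitely many values in characteristic zero *)

Section Infinite.

Variable K : fieldType.
Hypothesis char0 : [pchar K] =i pred0.

Lemma natr_inj : injective (fun s : nat => s%:R : K).
Proof.
have nat0 (d : nat) : d%:R = 0 :> K -> d = 0%N.
  by move=> /eqP; rewrite ((pcharf0P K).1 char0) => /eqP.
move=> s t /= st; wlog le : s t st / (s <= t)%N.
  by move=> W; case/orP: (leq_total s t) => [/W->|/W->].
have /nat0 : (t - s)%:R = 0 :> K by rewrite natrB // st subrr.
by lia.
Qed.

Lemma two_exprz_eq1 (z : int) : 2%:R ^ z = 1 :> K -> z = 0.
Proof.
wlog : z / 0 <= z => [W|].
  case/orP: (le_total 0 z) => [/W//|z0 E].
  apply: oppr_inj; rewrite oppr0; apply: W; first by rewrite oppr_ge0.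
  by rewrite -invr_expz E invr1.
case: z => // z _; rewrite -exprnP -natrX => E0; have E : (2 ^ z)%N = 1%N by apply: natr_inj.
by congr Posz; case: z {E0} E => // z; rewrite expnS; lia.
Qed.

Lemma poly_nonroot (p : {poly K}) : p != 0 -> exists s : nat, p.[s%:R] != 0.
Proof.
move=> p0; pose rs := [seq s%:R : K | s <- iota 0 (size p)].
have : ~~ all (root p) rs.
  apply/negP => ar; have := max_poly_roots p0 ar.
  by rewrite map_inj_uniq ?iota_uniq //; [move=> /(_ isT); rewrite size_map size_iota ltnn | exact: natr_inj].
by case/allPn => _ /mapP[s _ ->]; exists s.
Qed.

End Infinite.

Section MovingLemma.

Variables (k : fieldType) (n : nat).
Hypothesis char0 : [pchar k] =i pred0.

(* Moving one coordinate with [m j != 0] along the line through [c0] breaks   *)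
(* the relation for all but finitely many values.                             *)
Lemma avoid_relation (f : {mpoly k[n]}) (c0 : {ffun 'I_n -> k}) (m : 'I_n -> int) :
  torus c0 -> f.@[c0] != 0 -> (exists j, m j != 0) ->
  exists c : {ffun 'I_n -> k}, [/\ torus c, f.@[c] != 0 & lmono c m != 1].
Proof.
move=> t0 f0 [j mj].
pose h l : {poly k} := if l == j then 'X else (c0 l)%:P.
pose c t := [ffun l => if l == j then t else c0 l] : {ffun 'I_n -> k}.
pose F := mmap (@polyC k) h f.
have FE t : F.[t] = f.@[c t].
  rewrite /F /mmap mevalE horner_sum; apply: eq_bigr => e _.
  rewrite hornerM hornerC; congr (_ * _); rewrite /mmap1 horner_prod.
  apply: eq_bigr => l _; rewrite horner_exp /h ffunE.
  by case: eqP => _; rewrite ?hornerX ?hornerC.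
pose q := \prod_(l | l != j) c0 l ^ m l.
have lE t : lmono (c t) m = t ^ m j * q.
  rewrite /lmono (bigD1 j) //= ffunE eqxx; congr (_ * _).
  by apply: eq_bigr => l /negbTE lj; rewrite ffunE lj.
pose G : {poly k} := 'X^`|m j|%N - (if 0 <= m j then q^-1 else q)%:P.
have G0 : G != 0.
  by rewrite -size_poly_eq0 size_XnsubC // absz_gt0.
have q0 : q != 0 by apply/prodf_neq0 => l _; rewrite expfz_neq0 // t0.
have F0 : F != 0.
  apply: contraNneq f0 => F0; have := FE (c0 j); rewrite F0 horner0 => E.
  suff -> : f.@[c0] = f.@[c (c0 j)] by rewrite -E.
  by apply: meval_eq => l; rewrite ffunE; case: eqP => [->|].
have : F * G * 'X != 0 by rewrite !mulf_neq0 ?polyX_eq0.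
case/(poly_nonroot char0) => s; rewrite !hornerM hornerX !mulf_eq0 !negb_or.
move=> /andP[/andP[Fs Gs] s0]; exists (c s%:R); split.
- by move=> l; rewrite ffunE; case: ifP.
- by rewrite -FE.
rewrite lE; apply: contraNneq Gs => E.
rewrite /G !hornerE subr_eq0.
case: (m j) E => z /= E.
  by rewrite exprnP -[_ ^ _](mulfK q0) E mul1r.
move: E; rewrite NegzE -invr_expz => E.
by rewrite exprnP -[X in X == _]invrK -[X in X^-1](mulfK q0) E mul1r invrK.
Qed.

(** Numerator of the Laurent equation [lmono c m = 1], negative exponents being moved to the other
    side; [Negz p] is minus [p.+1]. *)
Definition relation_poly (m : 'I_n -> int) : {mpoly k[n]} :=
  'X_[[multinom if m i is Posz p then p else 0%N | i < n]] -
  'X_[[multinom if m i is Negz p then p.+1 else 0%N | i < n]].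

Lemma relation_polyE m (c : {ffun 'I_n -> k}) : torus c ->
  ((relation_poly m).@[c] != 0) = (lmono c m != 1).
Proof.
move=> tc; rewrite mevalB !mevalX subr_eq0; congr (~~ _).
set A := (X in X == _); set B := (X in _ == X).
have B0 : B != 0 by apply/prodf_neq0 => i _; rewrite expf_neq0.
have -> : lmono c m = A / B.
  rewrite -prodf_div; apply: eq_bigr => i _; rewrite !mnmE.
  by case: (m i) => z; rewrite ?expr0 ?divr1 // NegzE -invr_expz div1r.
by rewrite -[RHS](inj_eq (mulIf B0)) divfK // mul1r.
Qed.

End MovingLemma.

(** * Solutions of binomial systems *)

Lemma finite_product (K : nmodType) (n : nat) (P : {ffun 'I_n -> K} -> Prop) :
  (forall i, exists L : seq K, forall v, P v -> v i \in L) ->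
  exists s : seq {ffun 'I_n -> K}, forall v, P v -> v \in s.
Proof.
move/fin_all_exists=> [Ls LsP]; pose L := flatten [seq Ls i | i <- enum 'I_n].
exists [seq [ffun i => L`_(val (f i))] | f : {ffun 'I_n -> 'I_(size L)}] => v Pv.
have vL i : (index (v i) L < size L)%N.
  rewrite index_mem; apply/flatten_mapP; exists i; rewrite ?mem_enum //.
  exact: LsP.
apply/imageP; exists [ffun i => Ordinal (vL i)] => //.
by apply/ffunP=> i; rewrite !ffunE /= nth_index // -index_mem.
Qed.

Section Solutions.

Variables (k : fieldType) (kbar : closedFieldType) (iota : {rmorphism k -> kbar}).
Hypothesis char0 : [pchar k] =i pred0.

Lemma closure_char0 : [pchar kbar] =i pred0.
Proof. by move=> p; rewrite (fmorph_pchar iota) char0. Qed.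

Lemma has_root (N : nat) (d : kbar) : (0 < N)%N -> exists y, y ^+ N = d.
Proof.
move=> N0; have [y E] := solve_monicpoly (fun i => if i == 0%N then d else 0) N0.
exists y; rewrite E -(prednK N0) big_ord_recl /= mulr1 big1 ?addr0 // => i _.
by rewrite mul0r.
Qed.

Lemma finite_roots (N : nat) (d : kbar) : (0 < N)%N ->
  exists L : seq kbar, forall y, y ^+ N = d -> y \in L.
Proof.
move=> N0; have [L E] := closed_field_poly_normal ('X^N - d%:P).
exists L => y yN.
have p0 : 'X^N - d%:P != 0 :> {poly kbar} by rewrite -size_poly_eq0 size_XnsubC.
have : root ('X^N - d%:P) y by rewrite rootE !hornerE yN subrr.
by rewrite E rootZ ?lead_coef_eq0 // root_prod_XsubC.
Qed.

Variable n : nat.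
Variables a b : 'I_n -> 'X_{1..n}.
Implicit Types (c : {ffun 'I_n -> k}) (v : {ffun 'I_n -> kbar}) (S : {set 'I_n}).

Definition mono v (e : 'X_{1..n}) : kbar := \prod_i v i ^+ e i.

Definition solution c v := forall j, mono v (a j) = iota (c j) * mono v (b j).

Definition pattern v : {set 'I_n} := [set i | v i != 0].

(** Replacing zeros by 1 makes all coordinates invertible without changing the monomials supported
    on the pattern, so negative exponents become available. *)
Definition patch v i : kbar := if v i == 0 then 1 else v i.

Lemma zero_setP c v : zero_set iota (binomial_ideal a b c) v <-> solution c v.
Proof.
have ev j : (map_mpoly iota (Defs.binomial a b c j)).@[v] =
    mono v (a j) - iota (c j) * mono v (b j).
  rewrite /Defs.binomial rmorphB /= map_mpolyZ !map_mpolyX.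
  by rewrite mevalB mevalZ !mevalX.
split=> [H j|H f [q ->]].
  apply/eqP; rewrite -subr_eq0 -ev H //.
  exists (fun l => (l == j)%:R); rewrite (bigD1 j) //= eqxx mul1r big1 ?addr0 //.
  by move=> l /negbTE->; rewrite mul0r.
rewrite (rmorph_sum (map_mpoly iota)) (rmorph_sum (meval v)) big1 //= => j _.
by rewrite rmorphM /= mevalM ev H subrr mulr0.
Qed.

Lemma mono_eq0 v e : (mono v e != 0) = (supp e \subset pattern v).
Proof.
apply/prodf_neq0/subsetP=> [H i|H i _].
  by rewrite !inE => ei; have := H i isT; rewrite expf_eq0 lt0n ei.
have := H i; rewrite !inE expf_eq0 negb_and lt0n negbK.
by case: eqP => //= _ /(_ isT) ->.
Qed.

Lemma patch_neq0 v i : patch v i != 0.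
Proof. by rewrite /patch; case: ifP => [_|->]; rewrite ?oner_neq0. Qed.

Lemma mono_patch v e : supp e \subset pattern v ->
  mono v e = lmono (patch v) (fun i => (e i)%:Z).
Proof.
move/subsetP=> s; apply: eq_bigr => i _; rewrite /patch.
case: eqP => [vi|//]; rewrite exp1rz.
have := s i; rewrite !inE vi eqxx; case: eqP => [->//|_ /(_ isT)//].
Qed.

Lemma lmono_dexp v j : lmono (patch v) (dexp a b j) =
  lmono (patch v) (fun i => (a j i)%:Z) / lmono (patch v) (fun i => (b j i)%:Z).
Proof.
rewrite -prodf_div; apply: eq_bigr => i _.
by rewrite expfzDr ?patch_neq0 // -invr_expz.
Qed.

Lemma solution_closed c v : torus c -> solution c v -> closed a b (pattern v).
Proof.
move=> tc sol; apply/closedP=> j; rewrite -!mono_eq0 sol mulf_eq0.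
by rewrite fmorph_eq0 (negbTE (tc j)).
Qed.

Lemma solution_inside c v : solution c v ->
  forall j, j \in inside a b (pattern v) -> lmono (patch v) (dexp a b j) = iota (c j).
Proof.
move=> sol j; rewrite inE => /andP[sa sb].
rewrite lmono_dexp -!mono_patch // sol mulfK // mono_eq0 //.
Qed.

Lemma solutionI c v : closed a b (pattern v) ->
  (forall j, j \in inside a b (pattern v) ->
     lmono (patch v) (dexp a b j) = iota (c j)) ->
  solution c v.
Proof.
move=> cl H j; have [jS|] := boolP (j \in inside a b (pattern v)).
  have := H j jS; move: jS; rewrite inE => /andP[sa sb].
  rewrite lmono_dexp -!mono_patch // => <-; rewrite divfK // mono_eq0 //.
rewrite (inside_closed _ cl) => /[dup] na.
rewrite (closedP _ _ _ cl) -!mono_eq0 => /negPn/eqP->.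
by move: na; rewrite -mono_eq0 => /negPn/eqP->; rewrite mulr0.
Qed.

(** Multiplying the equations inside the pattern, raised to the powers [m j], cancels the variables
    and leaves a monomial in [c]. *)
Lemma dependent_relation c v (m : 'I_n -> int) :
  solution c v ->
  (forall j, j \notin inside a b (pattern v) -> m j = 0) ->
  (forall i, \sum_j m j * dexp a b j i = 0) -> lmono c m = 1.
Proof.
move=> sol m0 mB; apply: (fmorph_inj iota); rewrite rmorph1 rmorph_prod /=.
transitivity (\prod_j lmono (patch v) (dexp a b j) ^ m j).
  apply: eq_bigr => j _; rewrite fmorphXz.
  have [jS|/m0 ->] := boolP (j \in inside a b (pattern v)); last by rewrite !expr0z.
  by rewrite (solution_inside sol).
rewrite -lmono_sum; last exact: patch_neq0.
by rewrite /lmono big1 // => i _; rewrite mB expr0z.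
Qed.

Lemma indep_solution c S : torus c -> closed a b S -> indep a b S ->
  exists2 v, solution c v & pattern v = S.
Proof.
move=> tc cl /indep_solve[N N0 [r rE]].
have /fin_all_exists [y yN] : forall j, exists y : kbar, y ^+ N = iota (c j).
  by move=> j; apply: has_root.
have y0 j : y j != 0.
  by have := tc j; apply: contra => /eqP yj; rewrite -(fmorph_eq0 iota) -yN yj expr0n gtn_eqF.
pose J := inside a b S.
(* By the choice of [r], the Laurent monomial of row [j] at [x] collapses to [y j ^ N]. *)
pose x i := \prod_(l in J) y l ^ r i l.
have x0 i : x i != 0 by apply/prodf_neq0 => l _; rewrite expfz_neq0.
pose v := [ffun i => if i \in S then x i else 0] : {ffun 'I_n -> kbar}.
have pv : pattern v = S.
  by apply/setP=> i; rewrite inE ffunE; case: ifP; rewrite ?x0 ?eqxx.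
exists v => //; apply: solutionI; rewrite pv // => j jS.
transitivity (lmono x (dexp a b j)).
  apply: eq_lmono => i; rewrite /patch ffunE.
  have [iS|iS] := boolP (i \in S); first by rewrite (negbTE (x0 i)).
  by rewrite (dexp_inside jS iS) !expr0z.
rewrite -yN exprnP /lmono.
transitivity (\prod_(l in J) y l ^ (\sum_i dexp a b j i * r i l)).
  under eq_bigr => i _ do rewrite /x prodrXz.
  rewrite exchange_big; apply: eq_bigr => l _.
  by rewrite exprz_sum //; apply: eq_bigr => i _; rewrite exprz_exp mulrC.
rewrite (bigD1 j) //= rE // eqxx mulr1 big1 ?mulr1 // => l /andP[lS /negbTE lj].
by rewrite rE // eq_sym lj mulr0 expr0z.
Qed.

Lemma deficient_infinite c v (L : seq {ffun 'I_n -> kbar}) :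
  torus c -> solution c v ->
  (#|inside a b (pattern v)| < #|pattern v|)%N ->
  exists2 v', solution c v' & v' \notin L.
Proof.
move=> tc sol /deficient_kernel[w [[i0 wi0] w0 wB]].
have two0 : 2%:R != 0 :> kbar by rewrite ((pcharf0P _).1 closure_char0).
(* Scaling along [w] fixes the Laurent monomial of every binomial inside the pattern; the points are
   distinct because 2 has infinite order. *)
pose vv (s : nat) := [ffun i => v i * (2%:R ^+ s) ^ w i] : {ffun 'I_n -> kbar}.
have pvv s : pattern (vv s) = pattern v.
  by apply/setP=> i; rewrite !inE ffunE mulf_eq0 negb_or expfz_neq0 ?andbT // expf_neq0.
have solv s : solution c (vv s).
  apply: solutionI; first by rewrite pvv; apply: solution_closed sol.
  rewrite pvv => j jS; rewrite -(solution_inside sol jS).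
  transitivity (lmono (patch v) (dexp a b j) * lmono (fun i => (2%:R ^+ s) ^ w i) (dexp a b j)).
    rewrite /lmono -big_split; apply: eq_bigr => i _ /=; rewrite -expfzMl; congr (_ ^ _).
    rewrite /patch ffunE mulf_eq0 (negbTE (expfz_neq0 _ _)) ?expf_neq0 // orbF.
    case: eqP => // /eqP vi; rewrite w0 ?expr0z ?mulr1 //.
    by rewrite inE negbK.
  rewrite -[RHS]mulr1; congr (_ * _); rewrite /lmono.
  under eq_bigr => i _ do rewrite exprz_exp mulrC.
  by rewrite -exprz_sum ?expf_neq0 // wB // expr0z.
have vi0 : v i0 != 0.
  by apply: contraNneq wi0 => vi; rewrite w0 // inE vi eqxx.
have inj : injective vv.
  move=> s t /ffunP/(_ i0); rewrite !ffunE => /(mulfI vi0).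
  rewrite !exprnP !exprz_exp => E.
  have : 2%:R ^ (s%:Z * w i0 - t%:Z * w i0) = 1 :> kbar.
    by rewrite expfzDr // E -invr_expz mulfV // expfz_neq0.
  move/(two_exprz_eq1 closure_char0); rewrite -mulrBl => /eqP.
  by rewrite mulf_eq0 (negbTE wi0) orbF subr_eq0 eqz_nat => /eqP.
have : ~~ all (mem L) [seq vv s | s <- seq.iota 0 (size L).+1].
  apply/negP => /allP sub.
  have := uniq_leq_size _ sub; rewrite map_inj_uniq ?iota_uniq //.
  by move=> /(_ isT); rewrite size_map size_iota ltnn.
by case/allPn => _ /mapP[s _ ->] sL; exists (vv s).
Qed.

Lemma full_finite c S : torus c -> indep a b S -> #|inside a b S| = #|S| ->
  exists L : seq {ffun 'I_n -> kbar},
  forall v, solution c v -> pattern v = S -> v \in L.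
Proof.
move=> tc iS cS.
suff [L LP] : exists L : seq {ffun 'I_n -> kbar},
    forall v, solution c v /\ pattern v = S -> v \in L.
  by exists L => v sv pv; apply: LP.
apply: finite_product => i; have [i_S|iS'] := boolP (i \in S); last first.
  exists [:: 0] => v [_ pv]; rewrite inE.
  by move: iS'; rewrite -pv inE negbK.
have [N N0 [m mE]] := full_span iS cS i_S.
have [L LP] := finite_roots (\prod_(j in inside a b S) iota (c j) ^ m j) N0.
exists L => v [sv pv]; apply: LP.
have -> : v i = patch v i.
  by move: i_S; rewrite -pv inE /patch => /negbTE->.
(* The exponent vector is [N] times the unit vector at [i], written as a combination of rows whose
   monomials are known. *)
transitivity (lmono (patch v) (fun i' => \sum_(j in inside a b S) m j * dexp a b j i')).
  rewrite /lmono (bigD1 i) //= mE eqxx mulr1 big1 ?mulr1 // => l /negbTE li.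
  by rewrite mE eq_sym li mulr0 expr0z.
rewrite lmono_sum; last exact: patch_neq0.
by apply: eq_bigr => j jS; rewrite (solution_inside sv) // pv.
Qed.

Lemma complete_intersection_full c S :
  torus c -> complete_intersection iota a b c -> closed a b S -> indep a b S ->
  #|inside a b S| = #|S|.
Proof.
move=> tc [[L LP] _] cl iS; apply/eqP; rewrite eqn_leq (indep_card iS) //= leqNgt.
apply/negP => lt.
have [v sv pv] := indep_solution tc cl iS.
rewrite -pv in lt; have [v' sv' /negP] := deficient_infinite L tc sv lt.
by apply; apply: LP; apply/zero_setP.
Qed.

Lemma complete_intersectionI c :
  torus c ->
  (exists2 S, closed a b S & indep a b S) ->
  (forall S, closed a b S -> indep a b S -> #|inside a b S| = #|S|) ->
  (forall v, solution c v -> indep a b (pattern v)) ->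
  complete_intersection iota a b c.
Proof.
move=> tc [S0 cl0 i0] full ind; split; last first.
  by have [v sv _] := indep_solution tc cl0 i0; exists v; apply/zero_setP.
have /fin_all_exists [Ls LsP] : forall S, exists L : seq {ffun 'I_n -> kbar},
    forall v, solution c v -> pattern v = S -> v \in L.
  move=> S; have [/andP[cl iS]|N] := boolP (closed a b S && indep a b S).
    by apply: full_finite => //; apply: full.
  exists [::] => v sv pv; case/negP: N.
  by rewrite -pv (solution_closed tc sv) ind.
exists (flatten [seq Ls T | T <- enum {set 'I_n}]) => v /zero_setP sv.
apply/flatten_mapP; exists (pattern v); first by rewrite mem_enum.
exact: LsP.
Qed.

Lemma complete_intersection_indepP c : torus c -> indep a b setT ->
  complete_intersection iota a b c <->
  (forall S, closed a b S -> #|inside a b S| = #|S|).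
Proof.
move=> tc iT.
have iS S : indep a b S by apply: indepS iT; apply: insideS; apply: subsetT.
split=> [ci S cl|full]; first exact: (complete_intersection_full tc).
apply: complete_intersectionI => // [|S cl _]; last exact: full.
by exists setT => //; apply/closedP=> j; rewrite !subsetT.
Qed.

(** Where no dependent [S] has its relation satisfied, every solution has an independent pattern and
    the combinatorial condition is equivalent to complete intersection. This locus is open and meets
    every nonempty open set. *)
Lemma gciP : gci iota a b <->
  (exists2 S, closed a b S & indep a b S) /\
  (forall S, closed a b S -> indep a b S -> #|inside a b S| = #|S|).
Proof.
have /fin_all_exists [m mP] : forall S, exists m : 'I_n -> int, ~~ indep a b S ->
    [/\ exists j, m j != 0, forall j, j \notin inside a b S -> m j = 0
      & forall i, \sum_j m j * dexp a b j i = 0].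
  move=> S; have [_|dS] := boolP (indep a b S); first by exists (fun=> 0).
  by have [m mS] := dep_relation dS; exists m.
(* One relation is broken at a time, by moving [c] while [f] and the relation polynomials already
   treated stay nonzero. *)
have avoid (f : {mpoly k[n]}) c0 (r : seq {set 'I_n}) : torus c0 -> f.@[c0] != 0 ->
    exists c, [/\ torus c, f.@[c] != 0 &
      (\prod_(S <- r | ~~ indep a b S) relation_poly k (m S)).@[c] != 0].
  move=> t0 f0; elim: r => [|S r [c [tc fc rc]]].
    by exists c0; split=> //; rewrite big_nil meval1 oner_neq0.
  rewrite big_cons; case: ifP => [dS|_]; last by exists c.
  have [mS _ _] := mP _ dS.
  have frc : (f * \prod_(S <- r | ~~ indep a b S) relation_poly k (m S)).@[c] != 0.
    by rewrite mevalM mulf_neq0.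
  have [c' [tc' fc' lc']] := avoid_relation char0 tc frc mS.
  move: fc'; rewrite mevalM mulf_eq0 negb_or => /andP[fc' rc'].
  by exists c'; split=> //; rewrite mevalM mulf_neq0 // relation_polyE.
pose f := \prod_(S | ~~ indep a b S) relation_poly k (m S).
have good c : torus c -> f.@[c] != 0 ->
    forall v, solution c v -> indep a b (pattern v).
  move=> tc fc v sv; apply: contraNT fc => dS.
  have [_ m0 mB] := mP _ dS; have := dependent_relation sv m0 mB.
  rewrite /f (bigD1 (pattern v)) //= mevalM mulf_eq0.
  by move/eqP; rewrite -[_ == 1]negbK -relation_polyE // negbK => ->.
split=> [[U [[F FP] [c0 /FP[t0 [g Fg gc0]]] ci]]|[ex full]].
  have [c [tc gc fc]] := avoid g c0 (index_enum _) t0 gc0.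
  have cic : complete_intersection iota a b c.
    by apply: ci; apply/FP; split=> //; exists g.
  split=> [|S]; last exact: complete_intersection_full cic.
  have [_ [v /zero_setP sv]] := cic; exists (pattern v).
    exact: solution_closed sv.
  exact: good sv.
exists (fun c => torus c /\ f.@[c] != 0); split.
- exists (fun g => g = f) => c; split=> [[tc fc]|[tc [g -> fc]]] //.
  by split=> //; exists f.
- have t1 : torus ([ffun=> 1] : {ffun 'I_n -> k}) by move=> j; rewrite ffunE oner_neq0.
  have [|c [tc _ fc]] := avoid 1 _ (index_enum _) t1; last by exists c.
  by rewrite meval1 oner_neq0.
- by move=> c [tc fc]; apply: complete_intersectionI => //; apply: good.
Qed.

End Solutions.

(** * Combinatorial criteria *)

Section Principal.

Variables (n : nat) (a b : 'I_n -> 'X_{1..n}).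
Implicit Types S T U : {set 'I_n}.

Definition generated T S : Prop :=
  [/\ closed a b S, T \subset S &
      forall U, closed a b U -> T \subset U -> S \subset U].

(** A binomial inside [S] or [T] is inside the union, and one inside both is inside the
    intersection. *)
Lemma inside_supermodular S T :
  (#|inside a b S| + #|inside a b T| <=
   #|inside a b (S :|: T)| + #|inside a b (S :&: T)|)%N.
Proof.
rewrite -cardsUI leq_add // subset_leq_card //.
  by rewrite subUset !insideS // (subsetUl, subsetUr).
by apply/subsetP=> j; rewrite !inE !subsetI => /andP[/andP[-> ->] /andP[-> ->]].
Qed.

(* A largest full subset of a closed independent [S] is all of [S]: joining   *)
(* to it the closed set generated by one more point keeps it full.            *)
Lemma full_principal C0 (C : 'I_n -> {set 'I_n}) :
  generated set0 C0 -> (forall i, generated [set i] (C i)) ->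
  ((exists2 S, closed a b S & indep a b S) /\
   (forall S, closed a b S -> indep a b S -> #|inside a b S| = #|S|)) <->
  (indep a b C0 /\ forall i, indep a b (C i) -> #|inside a b (C i)| = #|C i|).
Proof.
move=> [cl0 _ min0] gC; split=> [[[S clS iS] full]|[i0 full]]; split.
- by apply: indepS iS; apply/insideS/min0; rewrite ?sub0set.
- by move=> i; have [cli _ _] := gC i; apply: full.
- by exists C0.
move=> S clS iS; apply/eqP; rewrite eqn_leq (indep_card iS) //=.
pose good U := (U \subset S) && (#|U| <= #|inside a b U|)%N.
have good0 : good set0 by rewrite /good sub0set cards0.
have [U /maxsetP[/andP[sUS leU] maxU] _] := maxset_exists good0.
suff -> : S = U by [].
apply/eqP; rewrite eqEsubset sUS andbT; apply/subsetP=> i iinS.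
have [clC sC minC] := gC i; have sCS : C i \subset S by rewrite minC // sub1set.
have fC := full i (indepS (insideS _ _ sCS) iS).
have <- : C i :|: U = U; last by rewrite inE -sub1set sC.
apply: maxU; last exact: subsetUr.
rewrite /good subUset sCS sUS /=.
have leI : (#|inside a b (C i :&: U)| <= #|C i :&: U|)%N.
  by apply: (indep_card iS); rewrite subIset // sCS.
rewrite -(leq_add2r #|C i :&: U|) cardsUI.
apply: leq_trans (leq_add (leqnn _) leI).
by apply: leq_trans (inside_supermodular _ _); rewrite fC leq_add2l.
Qed.

End Principal.

(** * Vanishing sets and the removal of variables *)

Section Contraction.

Variable n : nat.
Implicit Types (F : nat -> {set 'I_n}) (I X : {set 'I_n}) (j u v : 'I_n).

(* The sets [F j] and [F (n + j)], for [j < n], are the supports of the two   *)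
(* monomials of the binomial [j]; [I] is the set of vanishing coordinates.    *)
Definition compat F I := forall j, [disjoint F j & I] = [disjoint F (n + j)%N & I].

Definition hit F I := [set j : 'I_n | ~~ [disjoint F j & I] || ~~ [disjoint F (n + j)%N & I]].

(** Fullness seen on complements. The opposite inequality is [hall], which holds initially by
    independence of the rows ([hall_support]). *)
Definition tight X F := forall I, I \subset X -> compat F I -> (#|hit F I| <= #|I|)%N.

Definition hall X F := forall I, I \subset X -> (#|I| <= #|hit F I|)%N.

Lemma disjoint_set0 I : [disjoint (set0 : {set 'I_n}) & I].
Proof. by rewrite -setI_eq0 set0I. Qed.

Definition delete i F t := F t :\ i.

Lemma disjoint_delete I F i t : i \notin I ->
  [disjoint delete i F t & I] = [disjoint F t & I].
Proof.
move=> iI; rewrite -!setI_eq0 /delete setIDAC.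
by rewrite (setDidPl _) // disjoint_sym disjoints1 inE (negbTE iI) andbF.
Qed.

(** A compatible set cannot meet the partner of an empty support, so it avoids [i]; on sets avoiding
    [i], the deletion affects neither compatibility nor the binomials met. *)
Lemma delete_step X F j i :
  (F j = set0 /\ i \in F (n + j)%N) \/ (F (n + j)%N = set0 /\ i \in F j) ->
  (tight X F <-> tight (X :\ i) (delete i F)) /\
  (hall X F -> hall (X :\ i) (delete i F)).
Proof.
move=> fj.
have ni I : compat F I -> i \notin I.
  move=> /(_ j) cI; apply/negP => iI; case: fj cI => -[E iF].
    by rewrite E disjoint_set0 => /esym/pred0P/(_ i); rewrite /= iF iI.
  by rewrite E disjoint_set0 => /pred0P/(_ i); rewrite /= iF iI.
have same I : i \notin I -> hit (delete i F) I = hit F I.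
  by move=> iI; apply/setP=> l; rewrite !inE !disjoint_delete.
have samec I : i \notin I -> compat (delete i F) I <-> compat F I.
  by move=> iI; split=> c l; have := c l; rewrite !disjoint_delete.
split; last first.
  move=> h I; rewrite subsetD1 => /andP[sIX iI].
  by rewrite same //; apply: h.
split=> t I sIX cI.
  move: sIX; rewrite subsetD1 => /andP[sIX iI].
  by rewrite same //; apply: t => //; apply/samec.
have iI := ni _ cI; rewrite -same //; apply: t; last exact/samec.
by rewrite subsetD1 sIX.
Qed.

Definition rename u v F t := if u \in F t then v |: F t :\ u else F t.

Definition empty_row j F (t : nat) : {set 'I_n} :=
  if (t == val j) || (t == n + j)%N then set0 else F t.

Lemma merge_step X F j u v :
  F j = [set u] -> F (n + j)%N = [set v] -> u != v -> u \in X -> v \in X ->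
  let F' := empty_row j (rename u v F) in
  (tight X F <-> tight (X :\ u) F') /\ (hall X F -> hall (X :\ u) F').
Proof.
move=> Fu Fv uv uX vX F'.
(* A compatible set contains [u] exactly when it contains [v], so [lift] inverts dropping [u]. When
   [v] is in [I], lifting adds one variable [u] and one binomial [j], so both cardinals grow by
   1. *)
pose lift I := if v \in I then u |: I else I.
have eqd (l : 'I_n) : ((val l == val j) || (val l == n + j)%N = (l == j)) *
    ((n + l == val j)%N || (n + l == n + j)%N = (l == j)).
  rewrite eqn_add2l -!val_eqE /=; have [ltl ltj] := (ltn_ord l, ltn_ord j).
  by split; [rewrite orbC|]; case: eqP => //=; lia.
have dE t I : u \notin I -> ~~ ((t == val j) || (t == n + j)%N) ->
    [disjoint F' t & I] = [disjoint F t & lift I].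
  move=> uI /negbTE nt; rewrite /F' /empty_row nt /rename /lift.
  have [uF|uF] := boolP (u \in F t); have [vI|vI] := boolP (v \in I).
  - transitivity false; [|symmetry]; apply/negP=> /pred0P.
      by move/(_ v); rewrite /= !inE eqxx vI.
    by move/(_ u); rewrite /= !inE uF eqxx.
  - rewrite -!setI_eq0 setIUl setU_eq0 setIDAC setIC.
    rewrite (setDidPl _); first by rewrite setI_eq0 disjoint_sym disjoints1 vI.
    by rewrite disjoint_sym disjoints1 inE (negbTE uI) andbF.
  - by rewrite -!setI_eq0 setIUr setU_eq0 [F t :&: [set u]]setIC [in X in X && _]setI_eq0 disjoints1 uF.
  - by [].
have hitj I : u \notin I -> (j \in hit F' I) = false.
  by move=> uI; rewrite inE /F' /empty_row !eqxx orbT !disjoint_set0.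
have hitl I l : u \notin I -> l != j -> (l \in hit F' I) = (l \in hit F (lift I)).
  move=> uI lj.
  by rewrite !inE !dE // ?eqd // (negbTE lj).
have hitjl I : u \notin I -> (j \in hit F (lift I)) = (v \in I).
  move=> uI; rewrite inE Fu Fv !disjoints1 /lift; case: ifP => vI.
    by rewrite !inE eqxx.
  by rewrite (negbTE uI) vI.
have chit I : u \notin I -> #|hit F (lift I)| = ((v \in I) + #|hit F' I|)%N.
  move=> uI; rewrite (cardsD1 j) hitjl //; congr (_ + _)%N.
  rewrite [in RHS](cardsD1 j) hitj // add0n; apply: eq_card => l.
  by rewrite !in_setD1; case: eqP => //= /eqP lj; rewrite hitl.
have clift I : u \notin I -> #|lift I| = ((v \in I) + #|I|)%N.
  by move=> uI; rewrite /lift; case: (v \in I); rewrite ?cardsU1 ?uI.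
have complift I : u \notin I -> compat F' I <-> compat F (lift I).
  move=> uI; split=> c l; have := c l.
    have [->|lj] := eqVneq l j; last by rewrite !dE // ?eqd // (negbTE lj).
    move=> _; rewrite Fu Fv !disjoints1 /lift; case: ifP => vI.
      by rewrite !inE eqxx vI orbT.
    by rewrite (negbTE uI) vI.
  have [->|lj] := eqVneq l j; last by rewrite !dE // ?eqd // (negbTE lj).
  by move=> _; rewrite /F' /empty_row !eqxx orbT !disjoint_set0.
have slift I : u \notin I -> I \subset X -> lift I \subset X.
  by move=> uI sIX; rewrite /lift; case: ifP => // _; rewrite subUset sub1set uX.
split; last first.
  move=> h I; rewrite subsetD1 => /andP[sIX uI].
  by rewrite -(leq_add2l (v \in I)) -clift // -chit // h // slift.
split=> t I sIX cI.
  move: sIX; rewrite subsetD1 => /andP[sIX uI].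
  rewrite -(leq_add2l (v \in I)) -clift // -chit //; apply: t; first exact: slift.
  by apply/complift.
have uvI : (u \in I) = (v \in I).
  by have := cI j; rewrite Fu Fv !disjoints1 => /negb_inj.
have uI' : u \notin I :\ u by rewrite !inE eqxx.
have lI : lift (I :\ u) = I.
  rewrite /lift !inE eq_sym uv /= -uvI; case: ifP => uI; first by rewrite setD1K.
  by apply/setDidPl; rewrite disjoint_sym disjoints1 uI.
rewrite -lI chit // clift // leq_add2l; apply: t; last by apply/complift; rewrite ?lI.
exact: setSD.
Qed.

Definition stable F : Prop :=
  (forall j, (F j == set0) = (F (n + j)%N == set0)) /\
  (forall j u v, F j = [set u] -> F (n + j)%N = [set v] -> u = v).

Definition vacuous F := [set j : 'I_n | F j == set0].

Definition owned F := [set u | [exists j : 'I_n, (F j == [set u]) || (F (n + j)%N == [set u])]].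

(* A variable [u] that is not owned gives the compatible set [X :\ u]; if all *)
(* are owned, then distinct variables outside a compatible set are owned by   *)
(* distinct binomials which do not meet that set.                             *)
Lemma stable_tight X F :
  (forall j, F j \subset X /\ F (n + j)%N \subset X) -> stable F -> hall X F ->
  tight X F <-> (n <= #|vacuous F| + #|owned F|)%N.
Proof.
move=> sFX [st0 st1] hX.
have hX0 : hit F X = ~: vacuous F.
  apply/setP=> j; have [sA sB] := sFX j.
  by rewrite !inE -!setI_eq0 (setIidPl sA) (setIidPl sB) -st0 orbb.
have cX : compat F X.
  by move=> j; have [sA sB] := sFX j; rewrite -!setI_eq0 (setIidPl sA) (setIidPl sB).
have cvac : (#|vacuous F| + #|hit F X| = n)%N by rewrite hX0 cardsC card_ord.
have ownX : owned F \subset X.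
  apply/subsetP=> u; rewrite inE => /existsP[j]; have [sA sB] := sFX j.
  by case/orP=> /eqP E; rewrite -sub1set -E.
have hall_hit (I : {set 'I_n}) : I \subset X -> hit F I \subset hit F X.
  move=> sIX; rewrite hX0; apply/subsetP=> j; rewrite !inE.
  by apply: contraL => F0; have := F0; rewrite st0 (eqP F0) => /eqP->; rewrite !disjoint_set0.
split=> [t|le_n].
  have eX : #|hit F X| = #|X| by apply/eqP; rewrite eqn_leq t //= hX.
  suff -> : owned F = X by rewrite -eX cvac.
  apply/eqP; rewrite eqEsubset ownX; apply/subsetP=> u uX.
  apply/negPn/negP; rewrite inE negb_exists => /forallP no.
  have meet t' : F t' \subset X -> F t' != [set u] ->
      [disjoint F t' & X :\ u] = (F t' == set0).
    move=> sF nF; rewrite -setI_eq0 setIDA (setIidPl sF) setD_eq0 subset1 (negbTE nF).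
    by [].
  have cXu : compat F (X :\ u).
    move=> j; have [sA sB] := sFX j; have := no j; rewrite negb_or => /andP[nA nB].
    by rewrite !meet.
  have := t _ (subsetDl _ _) cXu.
  have -> : hit F (X :\ u) = hit F X.
    apply/setP=> j; have [sA sB] := sFX j; have := no j; rewrite negb_or => /andP[nA nB].
    by rewrite hX0 !inE !meet // -st0 orbb.
  by rewrite eX (cardsD1 u X) uX add1n ltnn.
move=> I sIX cI.
have leX : (#|hit F X| <= #|owned F|)%N by rewrite -(leq_add2l #|vacuous F|) cvac.
pose own u := odflt (Ordinal (ltn_ord u)) [pick j : 'I_n | (F j == [set u]) || (F (n + j)%N == [set u])].
have ownP u : u \in owned F -> (F (own u) == [set u]) || (F (n + own u)%N == [set u]).
  rewrite inE /own => /existsP[j0 Hj0]; case: pickP => [j //|/(_ j0)].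
  by rewrite Hj0.
have own_inj : {in owned F &, injective own}.
  move=> u v /ownP Hu /ownP Hv E; rewrite -E in Hv.
  by case/orP: Hu => /eqP Eu; case/orP: Hv => /eqP Ev;
    do ?[by apply: set1_inj; rewrite -Eu -Ev];
    [exact: st1 Eu Ev|exact/esym/(st1 _ _ _ Ev Eu)].
have ownhit : own @: (owned F :\: I) \subset hit F X :\: hit F I.
  apply/subsetP=> j0 /imsetP[u /setDP[/ownP Hu uI] ->].
  have cj := cI (own u).
  rewrite inE hX0 !inE negb_or !negbK -cj andbb.
  case/orP: Hu => /eqP Eu.
    rewrite Eu disjoints1 uI /=; apply/set0Pn; exists u; exact: set11.
  rewrite cj Eu disjoints1 uI /= st0 Eu; apply/set0Pn; exists u; exact: set11.
have := subset_leq_card ownhit; rewrite card_in_imset; last first.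
  by move=> u v /setDP[uo _] /setDP[vo _]; apply: own_inj.
rewrite !cardsD (setIidPr (hall_hit _ sIX)).
have := subset_leq_card (hall_hit _ sIX); have := subset_leq_card (subsetIr (owned F) I).
have := subset_leq_card (subsetIl (owned F) I); move: leX.
move: #|hit F X| #|hit F I| #|owned F| #|I| #|owned F :&: I| => x y z w s.
lia.
Qed.

End Contraction.

(** * Program rules and incidence tables *)

Notation scal k := (SA k (SC 0)).
Notation "x '+e' y" := (SOp OAdd x y) (at level 50, left associativity).
Notation "x '-e' y" := (SOp OSub x y) (at level 50, left associativity).
Notation "x '*e' y" := (SOp OMul x y) (at level 40, left associativity).
Notation "x '==e' y" := (SOp OEq x y) (at level 70).
Notation num := (SIn (SC 0)).
Notation "p ;; q" := (Then p q) (at level 90, right associativity).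

Section Rules.

Variables (n W : nat) (inp : nat -> int).
Implicit Types (s : store) (Q : store -> Prop) (p q : prog).

Lemma wp_put k i e Q s i' v :
  seval inp s i = Posz i' -> seval inp s e = v -> (`|v| < 2 ^ W)%N ->
  Q (upd s k i' v) -> wp n W inp (Put k i e) Q s.
Proof. by move=> Ei Ev lt q; rewrite /= Ev Ei. Qed.

Lemma wp_then p q Q s :
  wp n W inp p (wp n W inp q Q) s -> wp n W inp (p ;; q) Q s.
Proof. by []. Qed.

Lemma wp_test e p q Q s :
  (seval inp s e != 0 -> wp n W inp p Q s) ->
  (seval inp s e = 0 -> wp n W inp q Q s) -> wp n W inp (Test e p q) Q s.
Proof. by rewrite /=; case: eqP => [E _ /(_ E)|E /(_ isT)]. Qed.

Lemma wp_for k b Q s (Inv : nat -> store -> Prop) :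
  Inv 0%N (upd s k 0%N 0) ->
  (forall i s', (i < n)%N -> Inv i s' -> s' k 0%N = i%:Z ->
     wp n W inp b (fun s2 => Inv i.+1 (upd s2 k 0%N i.+1%:Z)) s') ->
  (forall s', Inv n s' -> Q s') -> wp n W inp (For k b) Q s.
Proof. by move=> I0 IS In; exists Inv; split. Qed.

Lemma wp_framed p Q R s : wp n W inp p R s ->
  (forall s', R s' -> (forall k, ~~ writes k p -> s' k = s k) -> Q s') ->
  wp n W inp p Q s.
Proof. by move=> /wp_frame w RQ; apply: wp_mono w => s' [r F]; apply: RQ. Qed.

End Rules.

Arguments wp_put {n W inp k i e Q s} i' v.

Lemma eq_idx n (i i' : 'I_n) t t' :
  (t * n + i == t' * n + i')%N = (t == t') && (i == i').
Proof.
have n0 : (0 < n)%N by apply: leq_ltn_trans (ltn_ord i).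
apply/eqP/andP=> [E|[/eqP-> /eqP->]//].
have := congr1 (fun x => (x %/ n)%N) E; have := congr1 (fun x => (x %% n)%N) E.
rewrite !modnMDl !divnMDl // !modn_small // !divn_small // !addn0.
by move=> /val_inj-> ->.
Qed.

Section Incidence.

Variables (n W : nat) (inp : nat -> int).
Hypothesis inp0 : inp 0%N = n%:Z.
Hypothesis smallW : (2 * n * n + 2 * n + 2 < 2 ^ W)%N.
Implicit Types (s : store) (Q : store -> Prop) (F : nat -> {set 'I_n}).

(* Array 0 holds the incidence matrix of the [2 * n] sets, array 1 their      *)
(* cardinals and array 2 the sums of their elements: the only element of a    *)
(* singleton is then read off in one step.                                    *)
Definition Inc s F : Prop := forall t, (t < 2 * n)%N ->
  [/\ forall i : 'I_n, s 0%N (t * n + i)%N = (i \in F t)%:Z,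
      s 1%N t = #|F t| & s 2%N t = (\sum_(i in F t) i)%N].

Definition set_row F t (X : {set 'I_n}) t' := if t' == t then X else F t'.

Lemma Inc_ext s F F' : (forall t, (t < 2 * n)%N -> F t = F' t) -> Inc s F -> Inc s F'.
Proof. by move=> E h t lt; rewrite -E //; apply: h. Qed.

Lemma Inc_frame s s' F : (forall k, (k < 3)%N -> s' k = s k) -> Inc s F -> Inc s' F.
Proof. by move=> E h t lt; rewrite !E //; apply: h. Qed.

Definition del (se ie : sx) : prog :=
  Test (SA 0 (se *e num +e ie))
    (Put 0 (se *e num +e ie) (SC 0) ;;
     Put 1 se (SA 1 se -e SC 1) ;;
     Put 2 se (SA 2 se -e ie))
    Done.

Definition add (se ie : sx) : prog :=
  Test (SA 0 (se *e num +e ie))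
    Done
    (Put 0 (se *e num +e ie) (SC 1) ;;
     Put 1 se (SA 1 se +e SC 1) ;;
     Put 2 se (SA 2 se +e ie)).

(** [del] and [add] evaluate their arguments again after altering arrays 0 to 2, so the value must
    survive such changes. *)
Definition scalar_val s (e : sx) (v : nat) : Prop :=
  forall s', (forall k, (2 < k)%N -> s' k = s k) -> seval inp s' e = v%:Z.

Lemma sum_ord_bound (X : {set 'I_n}) : (\sum_(i in X) i <= n * n)%N.
Proof.
apply: leq_trans (_ : \sum_(i in X) n <= _)%N; first by apply: leq_sum => i _; apply: ltnW.
by rewrite sum_nat_const leq_mul2r -[X in (_ <= X)%N]card_ord max_card orbT.
Qed.

Lemma small_card (X : {set 'I_n}) : (`|Posz #|X| | < 2 ^ W)%N.
Proof.
rewrite absz_nat; apply: leq_ltn_trans (max_card _) _.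
by rewrite card_ord; apply: leq_ltn_trans smallW; lia.
Qed.

Lemma small_sum (X : {set 'I_n}) : (`|Posz (\sum_(i in X) i)| < 2 ^ W)%N.
Proof.
rewrite absz_nat; apply: leq_ltn_trans (sum_ord_bound X) _.
by apply: leq_ltn_trans smallW; lia.
Qed.

Lemma wp_del se ie t (i : 'I_n) F s : (t < 2 * n)%N ->
  Inc s F -> scalar_val s se t -> scalar_val s ie i ->
  wp n W inp (del se ie) (fun s' => Inc s' (set_row F t (F t :\ i))) s.
Proof.
move=> lt I Es Ei; have [IM Ic Is] := I t lt.
have idx s' : (forall k, (2 < k)%N -> s' k = s k) ->
    seval inp s' (se *e num +e ie) = (t * n + i)%N.
  by move=> E; rewrite /= Es // Ei // inp0 -PoszM -PoszD.
apply: wp_test; rewrite -[seval _ _ _]/(s 0%N `|seval inp s (se *e num +e ie)|%N) idx // absz_nat IM.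
  case: (boolP (i \in F t)) => // iF _.
  have cF : #|F t| = (#|F t :\ i|).+1 by rewrite (cardsD1 i) iF.
  have sF : (\sum_(i' in F t) i' = i + \sum_(i' in F t :\ i) i')%N by rewrite (big_setD1 i).
  apply: wp_then; apply: (wp_put (t * n + i)%N 0) => //; first exact: idx.
    by rewrite expn_gt0.
  apply: wp_then; apply: (wp_put t #|F t :\ i|).
  - by apply: Es => k; case: k.
  - by rewrite /= Es /upd /= ?Ic ?cF; [rewrite intS addrC addKr|case].
  - exact: small_card.
  apply: (wp_put t (\sum_(i' in F t :\ i) i')%N).
  - by apply: Es => k; case: k => [|[|]].
  - by rewrite /= Es /upd /= ?Ei /= ?Is ?sF; [rewrite PoszD addrC addKr|case=> [|[|]]|case=> [|[|]]].
  - exact: small_sum.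
  move=> t' lt'; have [IM' Ic' Is'] := I t' lt'; rewrite /upd /= /set_row.
  split=> [i'||].
  - rewrite eq_idx IM'; case: eqP => [->|//] /=; rewrite !inE.
    by case: eqP.
  - by case: eqP.
  - by case: eqP.
case: (boolP (i \in F t)) => // iF _.
apply: Inc_ext I => t' _; rewrite /set_row; case: eqP => // ->.
by apply/esym/setDidPl; rewrite disjoint_sym disjoints1.
Qed.

Lemma wp_add se ie t (i : 'I_n) F s : (t < 2 * n)%N ->
  Inc s F -> scalar_val s se t -> scalar_val s ie i ->
  wp n W inp (add se ie) (fun s' => Inc s' (set_row F t (i |: F t))) s.
Proof.
move=> lt I Es Ei; have [IM Ic Is] := I t lt.
have idx s' : (forall k, (2 < k)%N -> s' k = s k) ->
    seval inp s' (se *e num +e ie) = (t * n + i)%N.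
  by move=> E; rewrite /= Es // Ei // inp0 -PoszM -PoszD.
apply: wp_test; rewrite -[seval _ _ _]/(s 0%N `|seval inp s (se *e num +e ie)|%N) idx // absz_nat IM.
  case: (boolP (i \in F t)) => // iF _.
  apply: Inc_ext I => t' _; rewrite /set_row; case: eqP => // ->.
  by apply/esym/setUidPr; rewrite sub1set.
case: (boolP (i \in F t)) => // iF _.
have cF : #|i |: F t| = (#|F t|).+1 by rewrite cardsU1 iF.
have sF : (\sum_(i' in i |: F t) i' = i + \sum_(i' in F t) i')%N by rewrite big_setU1.
have W1 : (1 < 2 ^ W)%N by apply: leq_ltn_trans smallW; lia.
apply: wp_then; apply: (wp_put (t * n + i)%N 1) => //; first exact: idx.
apply: wp_then; apply: (wp_put t #|i |: F t|).
- by apply: Es => k; case: k.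
- by rewrite /= Es /upd /= ?Ic ?cF; [rewrite intS addrC|case].
- exact: small_card.
apply: (wp_put t (\sum_(i' in i |: F t) i')%N).
- by apply: Es => k; case: k => [|[|]].
- by rewrite /= Es /upd /= ?Ei /= ?Is ?sF; [rewrite PoszD addrC|case=> [|[|]]|case=> [|[|]]].
- exact: small_sum.
move=> t' lt'; have [IM' Ic' Is'] := I t' lt'; rewrite /upd /= /set_row.
split=> [i'||].
- rewrite eq_idx IM'; case: eqP => [->|//] /=; rewrite !inE.
  by case: eqP.
- by case: eqP.
- by case: eqP.
Qed.

End Incidence.

(** * The quadratic reduction *)

Section Reduction.

Variables (n W : nat) (inp : nat -> int).
Hypothesis inp0 : inp 0%N = n%:Z.
Hypothesis smallW : (2 * n * n + 2 * n + 2 < 2 ^ W)%N.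
Implicit Types (s : store) (Q C : store -> Prop) (F G : nat -> {set 'I_n}).

Local Notation wp := (wp n W inp).
Local Notation scalar_val := (scalar_val inp).

Definition rows (op : sx -> prog) : prog :=
  For 3 (op (scal 3) ;; op (num +e scal 3)).

(** [F] is the family before the pass and [G] the one after; [C] is a side condition on which [op]
    may rely, insensitive to arrays 0 to 3. *)
Lemma wp_rows op F G C s :
  (forall se k, writes k (op se) -> (k < 3)%N) ->
  (forall s s', (forall k, (3 < k)%N -> s' k = s k) -> C s -> C s') ->
  (forall se t F' s, (t < 2 * n)%N -> Inc s F' -> F' t = F t ->
     scalar_val s se t -> C s ->
     wp (op se) (fun s' => Inc s' (set_row F' t (G t))) s) ->
  Inc s F -> C s -> wp (rows op) (fun s' => Inc s' G /\ C s') s.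
Proof.
move=> Wop FC Hop I0 C0.
pose done j t := (t < j)%N || (n <= t < n + j)%N.
have noW se k : (2 < k)%N -> ~~ writes k (op se).
  by move=> lt; apply/negP => /Wop; rewrite ltnNge lt.
apply: (wp_for (Inv := fun j s => Inc s (fun t => if done j t then G t else F t) /\ C s)).
- split; last by apply: FC C0; case=> [|[|[|[|k]]]].
  apply: Inc_ext (I0 : Inc (upd s 3 0 0) F) => t lt.
  by rewrite (_ : done 0%N t = false) // /done; lia.
- move=> j s' ltj [I C'] s'j; apply: wp_then.
  have Dj : done j j = false by rewrite /done; lia.
  have Dnj : done j (n + j)%N = false by rewrite /done; lia.
  have njj : (n + j == j)%N = false by apply/eqP; lia.
  have DS t : (t < 2 * n)%N -> done j.+1 t = [|| t == j, t == (n + j)%N | done j t].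
    by rewrite /done; lia.
  have ltj2 : (j < 2 * n)%N by lia.
  have ltnj2 : (n + j < 2 * n)%N by lia.
  apply: wp_framed (Hop (scal 3) j _ s' ltj2 I _ _ C') _.
  + by rewrite Dj.
  + by move=> s2 E /=; rewrite E.
  move=> s1 I1 F1; have s1j : s1 3%N 0%N = j by rewrite F1 ?noW.
  have C1 : C s1 by apply: FC C' => k lt; rewrite F1 ?noW // ltnW.
  apply: wp_framed (Hop (num +e scal 3) (n + j)%N _ s1 ltnj2 I1 _ _ C1) _.
  + by rewrite /set_row njj Dnj.
  + by move=> s2 E /=; rewrite E // s1j inp0.
  move=> s2 I2 F2; split; last first.
    by apply: FC C1 => k lt; rewrite upd_neq ?F2 ?noW //; [exact: ltnW|apply/eqP; lia].
  apply: Inc_ext (I2 : Inc (upd s2 3 0 j.+1) _) => t lt; rewrite /set_row DS //.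
  by case: eqP => [->|_]; [rewrite orbT|case: eqP => [->|_]].
- move=> s' [I C']; split=> //; apply: Inc_ext I => t lt.
  by rewrite (_ : done n t = true) // /done; lia.
Qed.

Definition support t : {set 'I_n} := [set i : 'I_n | inp (1 + (t * n + i)) != 0].

Definition init : prog :=
  For 4 (rows (fun se =>
    Test (SIn (SC 1 +e (se *e num +e scal 4))) (add se (scal 4)) Done)).

Lemma wp_init s : Inc s (fun=> set0 : {set 'I_n}) -> wp init (fun s' => Inc s' support) s.
Proof.
move=> I0.
pose part j t := [set i in support t | (i < j)%N].
apply: (wp_for (Inv := fun i s => Inc s (part i))).
- apply: Inc_ext (I0 : Inc (upd s 4 0 0) _) => t _.
  by apply/setP=> i; rewrite !inE ltn0 andbF.
- move=> i s' lti I s'i.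
  apply: wp_mono (wp_rows (G := part i.+1) (C := fun s => s 4%N 0%N = i) _ _ _ I s'i).
  + by move=> s2 [I2 _]; exact: (I2 : Inc (upd s2 4 0 i.+1) _).
  + by move=> se k /=; rewrite orbF; case: k => [|[|[|k]]].
  + by move=> s1 s2 E <-; rewrite E.
  + move=> se t F' s1 ltt I1 Ft Es s1i.
    have E : seval inp s1 (SIn (SC 1 +e (se *e num +e scal 4))) = inp (1 + (t * n + i))%N.
      by rewrite /= Es // inp0 s1i -PoszM -!PoszD.
    have partS : part i.+1 t = if inp (1 + (t * n + i))%N != 0 then Ordinal lti |: part i t else part i t.
      apply/setP=> l; rewrite !inE ltnS leq_eqVlt andb_orr -[l == _ :> nat]/(l == Ordinal lti).
      case: ifP => [|/negbFE/eqP] N; rewrite !inE;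
        case: (l =P Ordinal lti) => [->|_];
        by rewrite /= ?N ?eqxx ?andbT ?andbF.
    apply: wp_test; rewrite E.
      move=> N; rewrite partS N -Ft; apply: wp_add => //.
      by move=> s2 E2 /=; rewrite E2.
    move=> N; apply: Inc_ext I1 => t' _; rewrite /set_row partS N eqxx /=.
    by case: eqP => // ->.
- move=> s' I; apply: Inc_ext I => t _.
  by apply/setP=> i; rewrite !inE ltn_ord andbT.
Qed.

Definition row_stable F (j : 'I_n) : Prop :=
  (F j == set0) = (F (n + j)%N == set0) /\
  (forall u v, F j = [set u] -> F (n + j)%N = [set v] -> u = v).

Definition half_empty F t : Prop :=
  (t < 2 * n)%N /\ F t != set0 /\
  exists j : 'I_n, (F j = set0 /\ t = (n + j)%N) \/ (F (n + j)%N = set0 /\ t = j).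

Definition mergeable F (j u v : 'I_n) : Prop :=
  [/\ F j = [set u], F (n + j)%N = [set v] & u != v].

(* Scalar 6 tells which kind of step applies, scalar 7 to which row. *)
Definition search_result F s (P : Prop) : Prop :=
  [\/ s 6%N 0%N = 0 /\ P,
      s 6%N 0%N = 1 /\ (exists2 t, s 7%N 0%N = Posz t & half_empty F t)
    | s 6%N 0%N = 2 /\ (exists2 j : 'I_n, s 7%N 0%N = Posz j & exists u v, mergeable F j u v)].

Definition card_is (se : sx) (c : nat) : sx := SA 1 se ==e SC c.

Lemma wp_test_card se t c p q Q s F :
  Inc s F -> (t < 2 * n)%N -> seval inp s se = Posz t ->
  (#|F t| = c -> wp p Q s) -> (#|F t| <> c -> wp q Q s) ->
  wp (Test (card_is se c) p q) Q s.
Proof.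
move=> I lt E Hp Hq; have [_ cF _] := I _ lt.
have ec : seval inp s (card_is se c) = (#|F t| == c)%:Z by rewrite /= E /= cF.
by apply: wp_test; rewrite ec; case: (#|F t| =P c) => // H _; [exact: Hp|exact: Hq].
Qed.

(** One pass with constant work per row: emptiness and singletons are read off the cardinals, and
    singletons are compared by their sums. A later find overwrites an earlier one. *)
Definition search : prog :=
  Put 6 (SC 0) (SC 0) ;;
  For 3
    (Test (card_is (scal 3) 0)
      (Test (card_is (num +e scal 3) 0)
        Done
        (Put 6 (SC 0) (SC 1) ;; Put 7 (SC 0) (num +e scal 3)))
      (Test (card_is (num +e scal 3) 0)
        (Put 6 (SC 0) (SC 1) ;; Put 7 (SC 0) (scal 3))
        (Test (card_is (scal 3) 1 *e card_is (num +e scal 3) 1 *e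
               (SC 1 -e (SA 2 (scal 3) ==e SA 2 (num +e scal 3))))
          (Put 6 (SC 0) (SC 2) ;; Put 7 (SC 0) (scal 3))
          Done))).

Lemma small_nat x : (x <= 2 * n + 2)%N -> (`|Posz x| < 2 ^ W)%N.
Proof. by rewrite absz_nat => le; apply: leq_ltn_trans smallW; lia. Qed.

Lemma wp_search s F : Inc s F ->
  wp search (fun s' => Inc s' F /\ search_result F s' (stable F)) s.
Proof.
move=> I; apply: wp_then; apply: (wp_put 0 0) => //; first exact: small_nat.
apply: (wp_for (Inv := fun j s => Inc s F /\
  search_result F s (forall l : 'I_n, (l < j)%N -> row_stable F l))).
- by split=> //; constructor 1; split.
- move=> j s' ltj [I' R] s'j; pose l := Ordinal ltj.
  have ltn2 : (n + j < 2 * n)%N by lia.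
  have ltj2 : (j < 2 * n)%N by lia.
  have Ej : seval inp s' (scal 3) = j by [].
  have Enj : seval inp s' (num +e scal 3) = (n + j)%N by rewrite /= inp0 s'j.
  have next s2 : (forall k, (7 < k)%N || (k < 3)%N -> s2 k = s' k) ->
      search_result F s2 (forall l : 'I_n, (l < j.+1)%N -> row_stable F l) ->
      Inc (upd s2 3 0 j.+1) F /\
      search_result F (upd s2 3 0 j.+1) (forall l : 'I_n, (l < j.+1)%N -> row_stable F l).
    move=> E R2; split=> //; apply: Inc_frame I' => k ltk.
    by rewrite upd_neq ?E ?ltk ?orbT //; apply/eqP; lia.
  have same : row_stable F l -> search_result F s' (forall l : 'I_n, (l < j.+1)%N -> row_stable F l).
    case: R => [[s6 H]|R|R] st; [constructor 1|constructor 2|constructor 3] => //.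
    split=> // l'; rewrite ltnS leq_eqVlt => /orP[/eqP E|]; last exact: H.
    by rewrite (_ : l' = l) //; apply: val_inj.
  have put k v p Q s1 : (v <= 2 * n + 2)%N ->
      forall e, seval inp s1 e = Posz v -> wp p Q (upd s1 k 0 v) ->
      wp (Put k (SC 0) e ;; p) Q s1.
    move=> lev e E w; apply: wp_then; apply: wp_put w => //; exact: small_nat.
  have half t e : half_empty F t -> seval inp (upd s' 6 0 1) e = Posz t ->
      wp (Put 6 (SC 0) (SC 1) ;; Put 7 (SC 0) e)
        (fun s2 => Inc (upd s2 3 0 j.+1) F /\
          search_result F (upd s2 3 0 j.+1) (forall l : 'I_n, (l < j.+1)%N -> row_stable F l)) s'.
    move=> hF E; apply: (put 6 1%N) => //; first by lia.
    apply: (wp_put 0 t) => //; first by apply: small_nat; case: hF; lia.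
    apply: next; first by case=> [|[|[|[|[|[|[|[|k]]]]]]]].
    by constructor 2; split=> //; exists t.
  apply: (wp_test_card I' ltj2 Ej) => [/eqP|/eqP]; rewrite cards_eq0 => A0.
    apply: (wp_test_card I' ltn2 Enj) => [/eqP|/eqP]; rewrite cards_eq0 => B0.
      apply: next => //; apply: same; split; first by rewrite A0 B0.
      by move=> u v; rewrite /= (eqP A0) => /setP/(_ u); rewrite !inE eqxx.
    apply: (half (n + j)%N) => //; do 2?split=> //.
    by exists l; left; split=> //; apply/eqP.
  apply: (wp_test_card I' ltn2 Enj) => [/eqP|/eqP]; rewrite cards_eq0 => B0.
    apply: (half j) => //; do 2?split=> //.
    by exists l; right; split=> //; apply/eqP.
  have [_ cA sA] := I' _ ltj2; have [_ cB sB] := I' _ ltn2.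
  have nj : absz (inp 0%N + s' 3%N 0%N)%R = (n + j)%N by rewrite inp0 s'j.
  have both : seval inp s' (card_is (scal 3) 1 *e card_is (num +e scal 3) 1 *e
               (SC 1 -e (SA 2 (scal 3) ==e SA 2 (num +e scal 3)))) =
     [&& #|F j| == 1%N, #|F (n + j)%N| == 1%N &
         (\sum_(i in F j) i != \sum_(i in F (n + j)%N) i)%N]%:Z.
    rewrite /= nj s'j /= cA cB sA sB !eqz_nat.
    by do 3 case: (_ == _).
  apply: wp_test; rewrite both.
    case: and3P => // -[/cards1P[u Eu] /cards1P[v Ev] ne] _.
    apply: (put 6 2%N) => //; first by lia.
    apply: (wp_put 0 j) => //; first by apply: small_nat; lia.
    apply: next; first by case=> [|[|[|[|[|[|[|[|k]]]]]]]].
    constructor 3; split=> //; exists l => //; exists u, v; split=> //.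
    by move: ne; rewrite Eu Ev !big_set1.
  case: and3P => // N _; apply: next => //; apply: same; split.
    by rewrite (negbTE A0) (negbTE B0).
  move=> u v /= Eu Ev; apply/eqP/negPn/negP => uv; apply: N.
  by rewrite Eu Ev !cards1 !big_set1.
- move=> s' [I' R]; split=> //.
  case: R => [[s6 H]|R|R]; [constructor 1|constructor 2|constructor 3] => //.
  split=> //; split=> l; first by case: (H l (ltn_ord l)).
  by case: (H l (ltn_ord l)).
Qed.
Definition delete_prog : prog :=
  For 4 (Test (SA 0 (scal 7 *e num +e scal 4)) (Put 8 (SC 0) (scal 4)) Done) ;;
  rows (fun se => del se (scal 8)).

Lemma wp_delete s F t : Inc s F -> s 7%N 0%N = Posz t -> half_empty F t ->
  wp delete_prog (fun s' => exists j i : 'I_n,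
    ((F j = set0 /\ i \in F (n + j)%N) \/ (F (n + j)%N = set0 /\ i \in F j)) /\
    Inc s' (delete i F)) s.
Proof.
move=> I s7 [lt2 [/set0Pn[i0 i0F] [j0 Hj]]]; apply: wp_then.
apply: (wp_for (Inv := fun i s => [/\ Inc s F, s 7%N 0%N = Posz t &
  (exists2 u : 'I_n, u \in F t & s 8%N 0%N = u) \/ (forall u : 'I_n, (u < i)%N -> u \notin F t)])).
- by split=> //; right.
- move=> i s' lti [I' s'7 H] s'i; pose l := Ordinal lti.
  have [IM _ _] := I' _ lt2.
  have E : seval inp s' (SA 0 (scal 7 *e num +e scal 4)) = (l \in F t)%:Z.
    by rewrite /= s'7 inp0 s'i -PoszM -PoszD absz_nat -(IM l).
  apply: wp_test; rewrite E; case: (boolP (l \in F t)) => // lF _.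
    apply: (wp_put 0 i) => //; first by apply: small_nat; lia.
    by split=> //; left; exists l.
  split=> //; case: H => [[u uF su]|H]; first by left; exists u.
  right=> u; rewrite ltnS leq_eqVlt => /orP[/eqP E'|]; last exact: H.
  by rewrite (_ : u = l) //; apply: val_inj.
move=> s' [I' s'7 [[u uF su]|]]; last by move=> /(_ i0 (ltn_ord i0)); rewrite i0F.
apply: wp_mono (wp_rows (G := delete u F) (C := fun s => s 8%N 0%N = u) _ _ _ I' su).
- move=> s2 [I2 _]; exists j0, u; split=> //.
  by case: Hj => -[E Et]; [left|right]; split; rewrite // -Et.
- by move=> se k /=; rewrite !orbF; case: k => [|[|[|k]]].
- by move=> s1 s2 E <-; rewrite E.
- move=> se t' F' s1 ltt I1 Ft Es s1u; rewrite /delete -Ft.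
  by apply: wp_del => // s2 E2 /=; rewrite E2.
Qed.

(** The sums of the two singletons are [u] and [v]. After renaming, both sets of row [j] equal the
    singleton of [v], and the last two deletions empty them. *)
Definition merge_prog : prog :=
  Put 8 (SC 0) (SA 2 (scal 7)) ;;
  Put 9 (SC 0) (SA 2 (num +e scal 7)) ;;
  rows (fun se => Test (SA 0 (se *e num +e scal 8))
                    (del se (scal 8) ;; add se (scal 9)) Done) ;;
  del (scal 7) (scal 9) ;;
  del (num +e scal 7) (scal 9).

Lemma wp_merge s F (j u v : 'I_n) : Inc s F -> s 7%N 0%N = Posz j -> mergeable F j u v ->
  wp merge_prog (fun s' => Inc s' (empty_row j (rename u v F))) s.
Proof.
move=> I s7 [Fu Fv uv].
have ltj := ltn_ord j.
have ltj2 : (j < 2 * n)%N by lia.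
have ltnj2 : (n + j < 2 * n)%N by lia.
have [_ _ su] := I _ ltj2; have [_ _ sv] := I _ ltnj2.
rewrite Fu big_set1 in su; rewrite Fv big_set1 in sv.
apply: wp_then; apply: (wp_put 0 u) => //; first by rewrite /= s7.
  by apply: small_nat; have := ltn_ord u; lia.
apply: wp_then; apply: (wp_put 0 v) => //.
- by rewrite /= /upd /= inp0 s7 -PoszD.
- by apply: small_nat; have := ltn_ord v; lia.
set s1 := upd _ _ _ _.
have I1 : Inc s1 F by [].
apply: wp_then.
apply: wp_mono (wp_rows (G := rename u v F)
  (C := fun s => [/\ s 7%N 0%N = j, s 8%N 0%N = u & s 9%N 0%N = v]) _ _ _ I1 _).
- move=> s2 [I2 [s27 s28 s29]]; apply: wp_then.
  have njj : (n + j == j)%N = false by apply/eqP; lia.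
  have vj : rename u v F j = [set v].
    by rewrite /rename Fu set11 setDv setU0.
  have vnj : rename u v F (n + j)%N = [set v].
    by rewrite /rename Fv inE (negbTE uv).
  apply: wp_framed (wp_del inp0 smallW (t := j) (i := v) _ I2 _ _) _ => //.
  + by move=> s' E /=; rewrite E.
  + by move=> s' E /=; rewrite E.
  move=> s3 I3 F3.
  have s37 : s3 7%N 0%N = j by rewrite F3.
  have s39 : s3 9%N 0%N = v by rewrite F3.
  apply: wp_mono (wp_del inp0 smallW (t := (n + j)%N) (i := v) _ I3 _ _) => //.
  + move=> s4; apply: Inc_ext => t lt; rewrite /set_row /empty_row njj vnj vj setDv.
    by case: (t =P (n + j)%N) => [->|]; rewrite ?orbT // orbF.
  + by move=> s' E /=; rewrite E // s37 inp0.
  + by move=> s' E /=; rewrite E.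
- by move=> se k /=; rewrite !orbF; case: k => [|[|[|k]]].
- by move=> s' s2 E [<- <- <-]; rewrite !E.
- move=> se t F' s' ltt I' Ft Es [s'7 s'8 s'9].
  have [IM _ _] := I' _ ltt.
  have E : seval inp s' (SA 0 (se *e num +e scal 8)) = (u \in F t)%:Z.
    by rewrite /= Es // inp0 s'8 -PoszM -PoszD absz_nat IM Ft.
  apply: wp_test; rewrite E /rename; case: (boolP (u \in F t)) => // uF _.
    apply: wp_then; apply: wp_framed (wp_del inp0 smallW (i := u) ltt I' Es _) _.
      by move=> s2 E2 /=; rewrite E2.
    move=> s2 I2 F2.
    apply: wp_mono (wp_add inp0 smallW (i := v) ltt I2 _ _) => //.
    + move=> s3; apply: Inc_ext => t' _; rewrite /set_row eqxx Ft.
      by case: eqP.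
    + move=> s3 E3; apply: Es => k lt; rewrite E3 ?F2 //.
      by move: lt; case: k => [|[|[|k]]].
    + by move=> s3 E3 /=; rewrite E3 // F2.
  apply: Inc_ext I' => t' _; rewrite /set_row.
  by case: eqP => // ->.
- by rewrite /s1 /upd.
Qed.

Lemma wp_test_scal k (c v : int) p q Q s : s k 0%N = v ->
  wp (if v == c then p else q) Q s -> wp (Test (scal k ==e SC c) p q) Q s.
Proof.
move=> sk H.
have ec : seval inp s (scal k ==e SC c) = (v == c)%:Z by rewrite /= sk.
by apply: wp_test; rewrite ec; case: eqP H.
Qed.

(** Each round is a fixed number of single loops, and removes a variable unless the family is
    already stable. *)
Definition reduce : prog :=
  For 5
    (search ;;
     Test (scal 6 ==e SC 1) delete_prog
       (Test (scal 6 ==e SC 2) merge_prog Done)).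

(* [X] is the set of remaining variables after [r] rounds. *)
Definition reduced (P : Prop) (r : nat) F : Prop := exists X : {set 'I_n},
  [/\ forall j : 'I_n, F j \subset X /\ F (n + j)%N \subset X, hall X F,
      P <-> tight X F & stable F \/ (#|X| + r <= n)%N].

Lemma reduced_delete P r F (j i : 'I_n) : reduced P r F ->
  (F j = set0 /\ i \in F (n + j)%N) \/ (F (n + j)%N = set0 /\ i \in F j) ->
  reduced P r.+1 (delete i F).
Proof.
move=> [X [sX hX PX st]] Hj; have [tD hD] := delete_step X Hj.
exists (X :\ i); split.
- by move=> l; have [sA sB] := sX l; rewrite !setSD.
- exact: hD.
- by rewrite PX.
- right; case: st => [[st _]|].
    by have := st j; case: Hj => -[-> iF]; rewrite eqxx; [move/esym|] => /eqP E; rewrite E inE in iF.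
  have iX : i \in X.
    by have [sA sB] := sX j; case: Hj => -[_ iF]; [move: sB|move: sA] => /subsetP; apply.
  by rewrite (cardsD1 i X) iX add1n addnS addSn.
Qed.

Lemma reduced_merge P r F (j u v : 'I_n) : reduced P r F -> mergeable F j u v ->
  reduced P r.+1 (empty_row j (rename u v F)).
Proof.
move=> [X [sX hX PX st]] [Fu Fv uv].
have [sA sB] := sX j; rewrite Fu Fv !sub1set in sA sB.
have [tD hD] := merge_step Fu Fv uv sA sB.
have sR t : F t \subset X -> empty_row j (rename u v F) t \subset X :\ u.
  move=> sF; rewrite /empty_row; case: ifP => _; first exact: sub0set.
  rewrite /rename; case: ifP => uF; last by rewrite subsetD1 sF uF.
  by rewrite subUset setSD // sub1set !inE eq_sym uv sB.
exists (X :\ u); split.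
- by move=> l; have [sl snl] := sX l; rewrite !sR.
- exact: hD.
- by rewrite PX.
- right; case: st => [[_ st]|]; first by rewrite (st _ _ _ Fu Fv) eqxx in uv.
  by rewrite (cardsD1 u X) sA add1n addnS addSn.
Qed.

Lemma wp_reduce P s F : Inc s F -> reduced P 0 F ->
  wp reduce (fun s' => exists F', [/\ Inc s' F', reduced P n F' & stable F']) s.
Proof.
move=> I red.
apply: (wp_for (Inv := fun r s => exists F', Inc s F' /\ reduced P r F')).
- by exists F.
- move=> r s' ltr {I red} [{}F [I red]] _; apply: wp_then.
  apply: wp_mono (wp_search I) => s1 [I1 R].
  case: R => [[s6 st]|[s6 [t s7 H]]|[s6 [j s7 [u [v H]]]]].
  + do 2 apply: (wp_test_scal s6).
    exists F; split; first exact: I1.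
    by case: red => X [sX hX PX _]; exists X; split=> //; left.
  + apply: (wp_test_scal s6).
    apply: wp_mono (wp_delete I1 s7 H) => s2 [j [i [Hj I2]]].
    by exists (delete i F); split=> //; apply: reduced_delete Hj.
  + do 2 apply: (wp_test_scal s6).
    apply: wp_mono (wp_merge I1 s7 H) => s2 I2.
    by exists (empty_row j (rename u v F)); split=> //; apply: reduced_merge H.
- move=> s' [F' [I' red']]; exists F'; split=> //.
  (* After [n] rounds without stability no variable remains, and a family of empty sets is stable as
     well. *)
  have [X [sX _ _ [//|]]] := red'.
  rewrite -[leqRHS]add0n leq_add2r leqn0 cards_eq0 => /eqP X0.
  have F0 (j : 'I_n) : F' j = set0 /\ F' (n + j)%N = set0.
    by have [] := sX j; rewrite X0 !subset0 => /eqP-> /eqP->.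
  split=> [j|j u v]; have [-> ->] := F0 j => //.
  by move/setP/(_ u); rewrite !inE eqxx.
Qed.

(* Array 11 marks the owned variables, scalar 10 counts them together with    *)
(* the vacuous rows.                                                          *)
Definition own (se : sx) : prog :=
  Test (card_is se 1 *e (SA 11 (SA 2 se) ==e SC 0))
    (Put 11 (SA 2 se) (SC 1) ;; Put 10 (SC 0) (scal 10 +e SC 1))
    Done.

Definition count_rows : prog :=
  For 4 (Put 11 (scal 4) (SC 0)) ;;
  Put 10 (SC 0) (SC 0) ;;
  For 3
    (Test (card_is (scal 3) 0) (Put 10 (SC 0) (scal 10 +e SC 1)) Done ;;
     own (scal 3) ;;
     own (num +e scal 3)).

Definition marked s c (O : {set 'I_n}) : Prop :=
  s 10%N 0%N = (c + #|O|)%N /\ forall u : 'I_n, s 11%N u = (u \in O)%:Z.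

Definition singles (X : {set 'I_n}) := [set u | X == [set u]].

Lemma wp_own se t c O s F : (t < 2 * n)%N -> (c <= n)%N -> Inc s F ->
  (forall s', (forall k, (k != 10)%N -> (k != 11)%N -> s' k = s k) -> seval inp s' se = Posz t) ->
  marked s c O ->
  wp (own se) (fun s' => marked s' c (O :|: singles (F t))) s.
Proof.
move=> lt lec I Es [m10 m11]; have [_ cF sF] := I _ lt.
have eF : seval inp s (card_is se 1 *e (SA 11 (SA 2 se) ==e SC 0)) =
    ((#|F t| == 1%N) && (s 11%N (\sum_(i in F t) i)%N == 0))%:Z.
  by rewrite /= Es //= cF sF /= eqz_nat; do 2 case: (_ == _).
apply: wp_test; rewrite eF; case: andP => //; [case|].
  move=> /cards1P[u Fu]; rewrite Fu big_set1 m11.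
  case: (boolP (u \in O)) => // uO _ _.
  have leO : (#|O| <= n)%N by rewrite -[leqRHS]card_ord max_card.
  have Es11 : seval inp s (SA 2 se) = u by rewrite /= Es //= sF Fu big_set1.
  apply: wp_then; apply: (wp_put u 1) => //; first by apply: (@small_nat 1); lia.
  apply: (wp_put 0 (c + #|O|).+1) => //; first by rewrite /= /upd /= m10 -PoszD addn1.
    rewrite absz_nat; apply: leq_ltn_trans smallW.
    by apply: (@leq_trans (n + n).+1); [rewrite ltnS leq_add|lia].
  have -> : singles [set u] = [set u].
    by apply/setP=> x; rewrite !inE (inj_eq set1_inj) eq_sym.
  split; first by rewrite /= setUC cardsU1 uO addnCA add1n.
  move=> x; rewrite /upd /= !inE -[x == u :> nat]/(x == u) m11.
  by case: (x =P u); rewrite ?orbT ?orbF.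
move=> N _; suff -> : O :|: singles (F t) = O by split.
apply/setUidPl/subsetP=> u; rewrite inE => /eqP Fu.
apply/negPn/negP => uO; apply: N; rewrite Fu cards1 big_set1 m11 (negbTE uO).
by [].
Qed.

Lemma wp_count s F : Inc s F ->
  wp count_rows (fun s' => s' 10%N 0%N = (#|vacuous F| + #|owned F|)%N) s.
Proof.
move=> I; apply: wp_then.
apply: (wp_for (Inv := fun i s => Inc s F /\ forall l : 'I_n, (l < i)%N -> s 11%N l = 0)) => //.
  move=> i s' lti [I' z] s'i; apply: (wp_put i 0) => //; first by rewrite expn_gt0.
  split=> // l; rewrite ltnS leq_eqVlt /upd /=.
  by case: eqP => [//|_] /= ltl; apply: z.
move=> s1 [I1 z]; apply: wp_then; apply: (wp_put 0 0) => //; first by rewrite expn_gt0.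
pose vac j := [set l : 'I_n | (l < j)%N && (F l == set0)].
pose ow j := [set u | [exists l : 'I_n, (l < j)%N && ((F l == [set u]) || (F (n + l)%N == [set u]))]].
have vac_le j : (#|vac j| <= n)%N by rewrite -[leqRHS]card_ord max_card.
apply: (wp_for (Inv := fun j s => Inc s F /\ marked s #|vac j| (ow j))).
- have vac0 : vac 0%N = set0 by apply/setP=> l; rewrite !inE.
  have ow0 : ow 0%N = set0 by apply/setP=> l; rewrite !inE; apply/existsP=> -[].
  split=> //; split; first by rewrite vac0 ow0 !cards0.
  by move=> u; rewrite ow0 inE; apply: z.
- move=> j s' ltj [I' M'] s'j; pose l := Ordinal ltj.
  have ltj2 : (j < 2 * n)%N by lia.
  have ltnj2 : (n + j < 2 * n)%N by lia.
  have leO (O : {set 'I_n}) : (#|O| <= n)%N by rewrite -[leqRHS]card_ord max_card.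
  have step1 : wp (Test (card_is (scal 3) 0) (Put 10 (SC 0) (scal 10 +e SC 1)) Done)
      (fun s' => marked s' #|vac j.+1| (ow j)) s'.
    have vacS : vac j.+1 = if F j == set0 then l |: vac j else vac j.
      apply/setP=> x; rewrite inE ltnS leq_eqVlt -[x == j :> nat]/(x == l) andb_orl.
      case: ifP => F0; rewrite ?inE; case: (x =P l) => //= ->; rewrite ?F0 ?andbT ?orbF ?orbT //=.
    rewrite vacS; case: M' => m10 m11.
    apply: (wp_test_card I' ltj2) => // /eqP; rewrite cards_eq0 => F0.
      rewrite F0; apply: (wp_put 0 (#|vac j| + #|ow j|).+1) => //.
      + by rewrite /= m10 -PoszD addn1.
      + rewrite absz_nat; apply: leq_ltn_trans smallW.
        by apply: (@leq_trans (n + n).+1); [rewrite ltnS leq_add|lia].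
      split=> //; rewrite /upd /= cardsU1 (_ : l \notin vac j) ?inE ?ltnn //.
    by rewrite (negbTE F0).
  apply: wp_then; apply: wp_framed step1 _ => s2 M2 F2; apply: wp_then.
  have I2 : Inc s2 F.
    by apply: Inc_frame I' => k ltk; apply: F2; case: k ltk => [|[|[|]]].
  have s2j : s2 3%N 0%N = j by rewrite F2.
  apply: wp_framed (wp_own ltj2 (vac_le _) I2 _ M2) _.
    by move=> s3 E3 /=; rewrite E3.
  move=> s3 M3 F3.
  have I3 : Inc s3 F.
    by apply: Inc_frame I2 => k ltk; apply: F3; case: k ltk => [|[|[|]]].
  have s3j : s3 3%N 0%N = j by rewrite F3.
  apply: wp_framed (wp_own ltnj2 (vac_le _) I3 _ M3) _.
    by move=> s4 E4 /=; rewrite E4 // s3j inp0.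
  move=> s4 M4 F4; split.
    by apply: Inc_frame I3 => k ltk; rewrite upd_neq ?F4 //; case: k ltk => [|[|[|]]].
  have -> : ow j.+1 = ow j :|: singles (F j) :|: singles (F (n + j)%N); last exact: M4.
  apply/setP=> u; rewrite !inE -orbA; apply/existsP/orP.
    case=> x /andP[]; rewrite ltnS leq_eqVlt => /orP[/eqP xj|ltx] H.
      by right; rewrite -xj.
    by left; apply/existsP; exists x; rewrite ltx.
  case=> [/existsP[x /andP[ltx H]]|H]; first by exists x; rewrite H ltnS ltnW.
  by exists l; rewrite ltnSn.
- move=> s2 [_ [-> _]]; congr (Posz (_ + _)); apply: eq_card => x; rewrite !inE ?ltn_ord //.
  by apply: eq_existsb => l; rewrite ltn_ord.
Qed.

End Reduction.

(** * Running time, input, and the quadratic algorithm *)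

Fixpoint deg (p : prog) : nat :=
  match p with
  | Done | Put _ _ _ => 0
  | Then p1 p2 => maxn (deg p1) (deg p2)
  | Test _ p1 p2 => maxn (deg p1) (deg p2)
  | For _ b => (deg b).+1
  end.

Fixpoint coef (p : prog) : nat :=
  match p with
  | Done => 1
  | Put k i e => (cost (locx k (compx i)) + cost (compx e)).+1
  | Then p1 p2 => coef p1 + coef p2
  | Test e p1 p2 => (cost (compx e) + (coef p1 + coef p2)).+1
  | For _ b => 21 + coef b
  end.

(** [deg] is the loop nesting depth. As [n] is positive, the overhead [9 + 12 * n] of a loop is
    absorbed by the 21 in [coef]. *)
Lemma time_le n p : (0 < n)%N -> (time n p <= coef p * n ^ deg p)%N.
Proof.
move=> n0; have mono d d' : (d <= d')%N -> (n ^ d <= n ^ d')%N by apply: leq_pexp2l.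
have pos d : (0 < n ^ d)%N by rewrite expn_gt0 n0.
elim: p => [|k i e|p1 IH1 p2 IH2|e p1 IH1 p2 IH2|k b IH].
- by [].
- by rewrite /= expn0 muln1.
- rewrite /= mulnDl leq_add //.
    by apply: leq_trans IH1 _; rewrite leq_mul2l mono ?leq_maxl ?orbT.
  by apply: leq_trans IH2 _; rewrite leq_mul2l mono ?leq_maxr ?orbT.
- have le1 : (time n p1 <= coef p1 * n ^ maxn (deg p1) (deg p2))%N.
    by apply: leq_trans IH1 _; rewrite leq_mul2l mono ?leq_maxl ?orbT.
  have le2 : (time n p2 <= coef p2 * n ^ maxn (deg p1) (deg p2))%N.
    by apply: leq_trans IH2 _; rewrite leq_mul2l mono ?leq_maxr ?orbT.
  rewrite -[time _ _]/(cost (compx e) + (time n p1 + time n p2)).+1.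
  rewrite -[coef _]/(cost (compx e) + (coef p1 + coef p2)).+1 -[deg _]/(maxn _ _).
  move: (n ^ _)%N (pos (maxn (deg p1) (deg p2))) le1 le2 => q q0 le1 le2.
  rewrite mulSn !mulnDl; have : (cost (compx e) <= cost (compx e) * q)%N by rewrite leq_pmulr.
  lia.
- rewrite -[time _ _]/(9 + n * (12 + time n b))%N -[coef _]/(21 + coef b)%N -[deg _]/(deg b).+1.
  rewrite expnS; move: (n ^ _)%N (pos (deg b)) IH => q q0 IH.
  have : (n * time n b <= n * (coef b * q))%N by rewrite leq_mul2l IH orbT.
  have : (n <= n * q)%N by rewrite leq_pmulr.
  nia.
Qed.

Definition answer (p : prog) (k : nat) : cmd := Seq (comp p) (Assign (Const 0) (scell k)).

Lemma decides_answer p k n (a b : 'I_n -> 'X_{1..n}) T W (P : Prop) :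
  (n < 2 ^ W)%N -> (k < stride)%N -> wf p -> (time n p + 4 <= T)%N ->
  wp n W (fun y => input a b (Posz y)) p
    (fun s => (`|s k 0%N| < 2 ^ W)%N /\ (s k 0%N != 0 <-> P)) (fun _ _ => 0) ->
  decides (answer p k) (input a b) T W P.
Proof.
move=> ltnW ltk wfp leT w.
have rep0 : rep (fun y => input a b (Posz y)) (input a b) (fun _ _ => 0) by [].
have [t [m' [s' [ex let' [rs _] [lt E]]]]] := wp_exec (erefl _) ltnW wfp rep0 w.
have ev : eval m' (scell k) = s' k 0%N by rewrite -rs // /loc muln0 addn0.
exists (t + 4)%N, (update m' 0 (s' k 0%N)); split.
- apply: ExecSeq ex _; rewrite -ev.
  by apply: (@ExecAssign W (Const 0) (scell k) m'); rewrite ev.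
- by apply: leq_trans leT; rewrite leq_add2r.
- by rewrite /update eqxx.
Qed.

Lemma nth_allpairs (S T R : Type) (x0 : R) (f : S -> T -> R) (s : seq S) (t : seq T) u v q r :
  (q < size s)%N -> (r < size t)%N ->
  nth x0 [seq f x y | x <- s, y <- t] (q * size t + r) = f (nth u s q) (nth v t r).
Proof.
elim: s q => [|x s IH] [|q] //= ltq ltr; rewrite nth_cat size_map.
  by rewrite mul0n add0n ltr (nth_map v).
by rewrite ltnNge mulSn -addnA leq_addr /= addKn IH.
Qed.

Section Input.

Variables (n : nat) (a b : 'I_n -> 'X_{1..n}).

Local Notation inp := (fun y : nat => input a b (Posz y)).

Lemma entries_nth (e : 'I_n -> 'X_{1..n}) (j i : 'I_n) :
  nth 0%N [seq e j i | j <- enum 'I_n, i <- enum 'I_n] (j * n + i) = e j i.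
Proof.
have := @nth_allpairs _ _ _ 0%N (fun j i => e j i) (enum 'I_n) (enum 'I_n) j i j i.
by rewrite size_enum_ord !nth_ord_enum => ->.
Qed.

Lemma entries_size (e : 'I_n -> 'X_{1..n}) :
  size [seq e j i | j <- enum 'I_n, i <- enum 'I_n] = (n * n)%N.
Proof. by rewrite size_allpairs size_enum_ord. Qed.

Lemma idx_lt (j i : 'I_n) : (j * n + i < n * n)%N.
Proof.
apply: (@leq_trans (j.+1 * n)); first by rewrite mulSn addnC ltn_add2r.
by rewrite leq_mul2r ltn_ord orbT.
Qed.

Lemma input_a (j i : 'I_n) : inp (1 + (j * n + i))%N = a j i.
Proof. by rewrite /= nth_cat entries_size idx_lt entries_nth. Qed.

Lemma input_b (j i : 'I_n) : inp (1 + ((n + j) * n + i))%N = b j i.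
Proof.
by rewrite /= add0n nth_cat entries_size mulnDl -addnA ltnNge leq_addr /= addKn entries_nth.
Qed.

Lemma support_a (j : 'I_n) : support n inp j = supp (a j).
Proof. by apply/setP=> i; rewrite !inE input_a. Qed.

Lemma support_b (j : 'I_n) : support n inp (n + j) = supp (b j).
Proof. by apply/setP=> i; rewrite !inE input_b. Qed.

Lemma compat_closed I : compat (support n inp) I <-> closed a b (~: I).
Proof.
split=> [c|/closedP c j].
  apply/closedP=> j; have := c j.
  by rewrite support_a support_b !disjoints_subset.
by have := c j; rewrite support_a support_b -!disjoints_subset.
Qed.

Lemma hit_inside I : hit (support n inp) I = ~: inside a b (~: I).
Proof.
by apply/setP=> j; rewrite !inE support_a support_b !disjoints_subset negb_and.
Qed.

Lemma card_hit I : (#|hit (support n inp) I| + #|inside a b (~: I)| = n)%N.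
Proof. by rewrite hit_inside addnC cardsC card_ord. Qed.

Lemma det_indep : \det (exponent_matrix a b) != 0 -> indep a b setT.
Proof.
move=> d0; apply/indepP=> w _ wB.
have u : Brat a b \in unitmx by rewrite unitmxE det_map_mx unitfE intr_eq0.
by rewrite -[w](mulmxK u) wB mul0mx.
Qed.

Lemma hall_support : indep a b setT -> hall setT (support n inp).
Proof.
move=> iT I _.
have le := indep_card iT (subsetT (~: I)).
rewrite -(leq_add2r #|inside a b (~: I)|) card_hit.
apply: leq_trans (leq_add (leqnn _) le) _.
by rewrite cardsC card_ord.
Qed.

Lemma tight_full : indep a b setT ->
  (forall S, closed a b S -> #|inside a b S| = #|S|) <-> tight setT (support n inp).
Proof.
move=> iT; have cC (I : {set 'I_n}) : (#|I| + #|~: I| = n)%N by rewrite cardsC card_ord.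
split=> [full I _ /compat_closed/full E|t S clS].
  by rewrite -(leq_add2r #|inside a b (~: I)|) card_hit E cC.
apply/eqP; rewrite eqn_leq (indep_card iT) ?subsetT //=.
have /t le : ~: S \subset setT by apply: subsetT.
have cS : compat (support n inp) (~: S) by apply/compat_closed; rewrite setCK.
have := card_hit (~: S); rewrite setCK => cH.
rewrite -(leq_add2l #|~: S|) [X in (X <= _)%N]addnC cC.
by rewrite -[X in (X <= _)%N]cH leq_add2r le.
Qed.

(** The left side is below the cube of [n + 1], and [n + 1] is at most [2 ^ L], with [L] the number
    of bits. *)
Lemma small_bits C : (0 < n)%N -> (3 <= C)%N ->
  (2 * n * n + 2 * n + 2 < 2 ^ (C * bits (n + max_exponent a b)))%N.
Proof.
move=> n0 C3; set L := bits _.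
have ltL : (n < 2 ^ L)%N.
  by apply: (@leq_ltn_trans (n + max_exponent a b)); rewrite ?leq_addr // /L /bits trunc_log_ltn.
have : (2 ^ (3 * L) <= 2 ^ (C * L))%N by rewrite leq_exp2l // leq_mul2r C3 orbT.
apply: leq_trans; rewrite (mulnC 3) expnM.
move: (2 ^ L)%N ltL => x ltx.
have : ((n + 1) * ((n + 1) * (n + 1)) <= x * (x * x))%N by rewrite !leq_mul // addn1.
rewrite !expnS expn0 muln1; nia.
Qed.

End Input.

Definition complete_intersection_prog : prog :=
  init ;; reduce ;; count_rows ;; Put 6 (SC 0) (SC 1 -e SOp OLt (scal 10) num).

Lemma wp_complete_intersection_prog n W (a b : 'I_n -> 'X_{1..n}) :
  (2 * n * n + 2 * n + 2 < 2 ^ W)%N -> indep a b setT ->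
  wp n W (fun y => input a b (Posz y)) complete_intersection_prog
    (fun s => (`|s 6%N 0%N| < 2 ^ W)%N /\
       (s 6%N 0%N != 0 <-> forall S, closed a b S -> #|inside a b S| = #|S|))
    (fun _ _ => 0).
Proof.
move=> smallW iT; have inp0 : (fun y => input a b (Posz y)) 0%N = n%:Z by [].
have I0 : Inc (fun _ _ => 0) (fun=> set0 : {set 'I_n}).
  by move=> t _; split=> [i||]; rewrite ?inE ?cards0 ?big_set0.
apply: wp_then; apply: wp_mono (wp_init inp0 smallW I0) => s1 I1.
set F0 := support _ _ in I1.
have red0 : reduced (forall S, closed a b S -> #|inside a b S| = #|S|) 0 F0.
  exists setT; split.
  - by move=> j; rewrite !subsetT.
  - exact: hall_support.
  - exact: tight_full.
  - by right; rewrite addn0 cardsT card_ord.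
apply: wp_then; apply: wp_mono (wp_reduce inp0 smallW I1 red0) => s2.
move=> [F [I2 [X [sX hX PX _]] st]].
apply: wp_then; apply: wp_mono (wp_count inp0 smallW I2) => s3 s3E.
have E : seval (fun y => input a b (Posz y)) s3 (SC 1 -e SOp OLt (scal 10) num) =
    (n <= #|vacuous F| + #|owned F|)%N%:Z.
  by rewrite /= s3E ltz_nat ltnNge; case: (n <= _)%N.
apply: (wp_put 0 _ _ E) => //.
  rewrite absz_nat; apply: leq_ltn_trans smallW.
  by apply: (@leq_trans 1%N); [exact: leq_b1|lia].
split.
  rewrite /upd /=; apply: leq_ltn_trans smallW.
  by apply: (@leq_trans 1%N); [exact: leq_b1|lia].
rewrite PX (stable_tight sX st hX) /upd /=.
by case: (n <= _)%N.
Qed.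

(** * Computing closures *)

(* Array 0 holds a set of variables, array 1 the set of the binomials inside  *)
(* it, array 2 the successive levels of the fraction-free elimination; the    *)
(* scalars 9 and 10 are the cardinals of the two sets, scalar 11 is the last  *)
(* pivot and scalar 6 the answer.                                             *)
Section Closures.

Variables (n W : nat) (a b : 'I_n -> 'X_{1..n}).
Hypothesis ltSnW : (n.+1 < 2 ^ W)%N.

Implicit Types (s : store) (Q C : store -> Prop) (X U : {set 'I_n}).

Local Notation inp := (fun y : nat => input a b (Posz y)).
Local Notation wp := (wp n W inp).

Definition in_a (row : sx) : sx := SIn (SC 1 +e (row *e num +e scal 4)).
Definition in_b (row : sx) : sx := in_a (num +e row).
Definition notx (e : sx) : sx := SC 1 -e e.

Lemma seval_a s row (j i : 'I_n) : seval inp s row = Posz j -> s 4%N 0%N = Posz i ->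
  seval inp s (in_a row) = a j i.
Proof.
move=> Ej Ei; rewrite -(input_a a b) /in_a -[LHS]/(inp (absz (1 + (seval inp s row * n + s 4%N 0%N)))).
by rewrite Ej Ei -PoszM -!PoszD.
Qed.

Lemma seval_b s row (j i : 'I_n) : seval inp s row = Posz j -> s 4%N 0%N = Posz i ->
  seval inp s (in_b row) = b j i.
Proof.
move=> Ej Ei; rewrite -(input_b a b) /in_b /in_a.
rewrite -[LHS]/(inp (absz (1 + ((n%:Z + seval inp s row) * n + s 4%N 0%N)))).
by rewrite Ej Ei -PoszD -PoszM -!PoszD.
Qed.

Lemma seval_eq s e e' : seval inp s (e ==e e') = (seval inp s e == seval inp s e')%:Z.
Proof. by []. Qed.

Lemma seval_mul s e e' : seval inp s (e *e e') = seval inp s e * seval inp s e'.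
Proof. by []. Qed.

Lemma seval_add s e e' : seval inp s (e +e e') = seval inp s e + seval inp s e'.
Proof. by []. Qed.

Lemma seval_sub s e e' : seval inp s (e -e e') = seval inp s e - seval inp s e'.
Proof. by []. Qed.

Lemma seval_quo s e e' :
  seval inp s (SOp OQuo e e') = (seval inp s e %/ seval inp s e')%Z.
Proof. by []. Qed.

Lemma seval_not s e (c : bool) : seval inp s e = c%:Z -> seval inp s (notx e) = (~~ c)%:Z.
Proof. by move=> E; rewrite /notx seval_sub E; case: c E. Qed.

Lemma seval_and s e e' (c c' : bool) : seval inp s e = c%:Z -> seval inp s e' = c'%:Z ->
  seval inp s (e *e e') = (c && c')%:Z.
Proof. by move=> E E'; rewrite seval_mul E E'; case: c c' {E E'} => [] []. Qed.

Lemma small_bool (c : bool) : (`|Posz c| < 2 ^ W)%N.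
Proof.
by rewrite absz_nat; apply: leq_ltn_trans (leq_b1 c) _; apply: leq_ltn_trans ltSnW.
Qed.

Lemma wp_put_bool k i e Q s i' (c : bool) :
  seval inp s i = Posz i' -> seval inp s e = c%:Z ->
  Q (upd s k i' c%:Z) -> wp (Put k i e) Q s.
Proof. by move=> Ei Ee q; apply: (wp_put i' c%:Z) => //; apply: small_bool. Qed.

Definition isset s X : Prop := forall i : 'I_n, s 0%N i = (i \in X)%:Z.

Definition subset_test k (row : sx) : sx :=
  scal k *e notx (notx (in_a row ==e SC 0) *e notx (SA 0 (scal 4))).

Definition closure_step : prog :=
  Put 7 (SC 0) (SC 1) ;;
  Put 8 (SC 0) (SC 1) ;;
  For 4 (Put 7 (SC 0) (subset_test 7 (scal 3)) ;;
         Put 8 (SC 0) (subset_test 8 (num +e scal 3))) ;;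
  Test (scal 7 ==e scal 8)
    Done
    (For 4 (Put 0 (scal 4)
       (notx (notx (SA 0 (scal 4)) *e
              ((in_a (scal 3) ==e SC 0) *e (in_b (scal 3) ==e SC 0)))))).

Definition balanced (j : 'I_n) X := (supp (a j) \subset X) == (supp (b j) \subset X).

(** An unbalanced binomial has exactly one support inside [X], so adding both amounts to adding the
    other. *)
Definition enlarge (j : 'I_n) X := if balanced j X then X else X :|: (supp (a j) :|: supp (b j)).

Definition below (e : 'X_{1..n}) X (i : nat) : bool :=
  [forall l : 'I_n, (l < i)%N ==> ((e l == 0%N) || (l \in X))].

Lemma belowS e X i (lti : (i < n)%N) :
  below e X i.+1 = below e X i && ((e (Ordinal lti) == 0%N) || (Ordinal lti \in X)).
Proof.
apply/forallP/andP=> [H|[/forallP H Hi] l].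
  split; last by have := H (Ordinal lti); rewrite ltnSn.
  by apply/forallP=> l; apply/implyP=> lt; have := H l; rewrite ltnS ltnW.
rewrite ltnS leq_eqVlt -[l == i :> nat]/(l == Ordinal lti).
by case: eqP => [->|_] //=; apply: H.
Qed.

Lemma below_full e X : below e X n = (supp e \subset X).
Proof.
apply/forallP/subsetP=> H l; first by rewrite inE => el; have := H l; rewrite ltn_ord (negbTE el).
by rewrite ltn_ord /=; have := H l; rewrite inE; case: eqP => //= _ /(_ isT).
Qed.

Lemma wp_closure_step s X (j : 'I_n) : isset s X -> s 3%N 0%N = Posz j ->
  wp closure_step (fun s' => isset s' (enlarge j X)) s.
Proof.
move=> sX s3; apply: wp_then; apply: (wp_put_bool (i' := 0%N) (c := true)) => //.
apply: wp_then; apply: (wp_put_bool (i' := 0%N) (c := true)) => //; apply: wp_then.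
apply: (wp_for (Inv := fun i s => [/\ isset s X, s 3%N 0%N = Posz j,
  s 7%N 0%N = (below (a j) X i)%:Z & s 8%N 0%N = (below (b j) X i)%:Z])).
- have b0 e : below e X 0 by apply/forallP.
  by split; rewrite //= /upd /= b0.
- move=> i s' lti [sX' s'3 s'7 s'8] s'4.
  have s'4l : s' 4%N 0%N = Posz (Ordinal lti) by [].
  have tst k row (e : 'X_{1..n}) s1 : (k != 0)%N -> s1 k 0%N = (below e X i)%:Z ->
      s1 0%N = s' 0%N -> s1 4%N = s' 4%N ->
      seval inp s1 (in_a row) = e (Ordinal lti) ->
      seval inp s1 (subset_test k row) = (below e X i.+1)%:Z.
    move=> k0 E1 E2 E3 E4; rewrite belowS /subset_test.
    apply: seval_and; first exact: E1.
    rewrite -[_ || _]negbK negb_or; apply/seval_not/seval_and; apply: seval_not.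
      by rewrite seval_eq E4 eqz_nat.
    by rewrite /= E2 E3 s'4 /= (sX' (Ordinal lti)).
  apply: wp_then; apply: (wp_put_bool (i' := 0%N) (c := below (a j) X i.+1)) => //.
    by apply: tst => //; apply: seval_a.
  apply: (wp_put_bool (i' := 0%N) (c := below (b j) X i.+1)) => //.
  by apply: tst => //; apply: (seval_b (row := scal 3)).
move=> s1 [sX1 s13 s17 s18]; rewrite !below_full in s17 s18.
have E : seval inp s1 (scal 7 ==e scal 8) = (balanced j X)%:Z.
  by rewrite /= s17 s18 /balanced eqz_nat; do 2 case: (_ \subset _).
rewrite /enlarge; apply: wp_test; rewrite E; case: (balanced j X) => // _.
set Y := X :|: _.
apply: (wp_for (Inv := fun i s => s 3%N 0%N = Posz j /\
   forall l : 'I_n, s 0%N l = (if (l < i)%N then l \in Y else l \in X)%:Z)).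
- by split=> // l; rewrite /upd /= sX1.
- move=> i s' lti [s'3 s'0] s'4; pose l := Ordinal lti.
  apply: (wp_put_bool (i' := i) (c := l \in Y)) => //.
    rewrite /Y !inE -[_ || _]negbK negb_or.
    apply/seval_not/seval_and; first by apply: seval_not; rewrite /= s'4 (s'0 l) ltnn.
    rewrite negb_or !negbK; apply: seval_and; rewrite seval_eq.
      by rewrite (seval_a (j := j) (i := l)) ?eqz_nat.
    by rewrite (seval_b (j := j) (i := l)) ?eqz_nat.
  split=> // l'; rewrite /upd /= ltnS leq_eqVlt.
  have [E'|ne] := eqVneq (l' : nat) i; first by rewrite (_ : l' = l) //; apply: val_inj.
  by rewrite s'0.
- by move=> s' [_ H] l; rewrite H ltn_ord.
Qed.

Definition closure : prog := For 5 (For 3 closure_step).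

(** A sweep that changes nothing certifies closedness and any other adds a variable, so [n] sweeps
    end in a closed set or in all variables, which is closed too. *)
Lemma wp_closure s X0 : isset s X0 ->
  wp closure (fun s' => exists2 X, isset s' X & generated a b X0 X) s.
Proof.
move=> sX0.
pose least X := forall U, closed a b U -> X0 \subset U -> X \subset U.
apply: (wp_for (Inv := fun q s => exists X, [/\ isset s X, X0 \subset X, least X &
  closed a b X \/ (q <= #|X|)%N])).
- by exists X0; split=> //; right.
- move=> q s1 ltq [X1 [sX1 s01 least1 Hq]] _.
  apply: (wp_for (Inv := fun j s => exists X, [/\ isset s X, X1 \subset X, least X &
    X = X1 -> forall l : 'I_n, (l < j)%N -> balanced l X1])).
  + by exists X1; split.
  + move=> j s2 ltj [X [sX s1X leastX HX]] s2j; pose l := Ordinal ltj.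
    apply: wp_mono (wp_closure_step (j := l) sX s2j) => s3 sE.
    exists (enlarge l X); split=> //.
    * by rewrite /enlarge; case: ifP => // _; apply: subset_trans s1X (subsetUl _ _).
    * move=> U clU s0U; have sXU := leastX U clU s0U.
      rewrite /enlarge; case: ifP => // /negbT nb.
      have := closedP _ _ _ clU l; rewrite !subUset sXU /=.
      have [sa|sa] := boolP (supp (a l) \subset X).
        by rewrite (subset_trans sa sXU) => <-.
      have [sb|sb] := boolP (supp (b l) \subset X).
        by rewrite (subset_trans sb sXU) => ->.
      by move: nb; rewrite /balanced (negbTE sa) (negbTE sb).
    * rewrite /enlarge; case: ifP => [bal E l'|nb E].
        rewrite ltnS leq_eqVlt => /orP[/eqP E'|]; last exact: HX.
        by rewrite -E (_ : l' = l) //; apply: val_inj.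
      have : supp (a l) :|: supp (b l) \subset X by apply: subset_trans s1X; rewrite -E subsetUr.
      by rewrite subUset => /andP[sa sb]; rewrite /balanced sa sb in nb.
  move=> s2 [X [sX s1X leastX HX]]; exists X; split=> //.
    exact: subset_trans s01 s1X.
  have [E|ne] := eqVneq X X1.
    by left; rewrite E; apply/forallP=> l; apply: HX.
  case: Hq => [cl|leq].
    by case/eqP: ne; apply/eqP; rewrite eqEsubset s1X leastX.
  right; apply: leq_ltn_trans leq _; apply: proper_card.
  by rewrite properEneq eq_sym ne.
- move=> s' [X [sX s0X leastX H]]; exists X => //; split=> //.
  case: H => // leX; suff -> : X = setT by apply/closedP=> j; rewrite !subsetT.
  by apply/eqP; rewrite eqEcard subsetT cardsT card_ord.
Qed.

Definition sizes : prog :=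
  Put 9 (SC 0) (SC 0) ;;
  Put 10 (SC 0) (SC 0) ;;
  For 3
    (Put 1 (scal 3) (SC 1) ;;
     For 4 (Put 1 (scal 3)
       (SA 1 (scal 3) *e notx (notx ((in_a (scal 3) ==e SC 0) *e (in_b (scal 3) ==e SC 0)) *e
                               notx (SA 0 (scal 4))))) ;;
     Put 9 (SC 0) (scal 9 +e SA 0 (scal 3)) ;;
     Put 10 (SC 0) (scal 10 +e SA 1 (scal 3))).

Lemma below2S (j : 'I_n) X i (lti : (i < n)%N) (l := Ordinal lti) :
  below (a j) X i.+1 && below (b j) X i.+1 =
  (below (a j) X i && below (b j) X i) &&
  ~~ (~~ ((a j l == 0%N) && (b j l == 0%N)) && ~~ (l \in X)).
Proof.
rewrite !belowS negb_and !negbK orbC -/l.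
by case: (below _ _ _); case: (below _ _ _); case: (l \in X);
   rewrite ?orbT ?orbF ?andbT ?andbF.
Qed.

Lemma wp_sizes s X : isset s X ->
  wp sizes (fun s' => [/\ isset s' X,
    forall j : 'I_n, s' 1%N j = (j \in inside a b X)%:Z,
    s' 9%N 0%N = #|X| & s' 10%N 0%N = #|inside a b X|]) s.
Proof.
move=> sX; apply: wp_then; apply: (wp_put_bool (i' := 0%N) (c := false)) => //.
apply: wp_then; apply: (wp_put_bool (i' := 0%N) (c := false)) => //.
pose upto (Y : {set 'I_n}) j := [set l in Y | (l < j)%N].
have upto0 Y : upto Y 0%N = set0 by apply/setP=> l; rewrite !inE andbF.
have uptoS Y j (ltj : (j < n)%N) :
    #|upto Y j.+1| = (#|upto Y j| + (Ordinal ltj \in Y))%N.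
  rewrite (cardsD1 (Ordinal ltj)) !inE ltnSn andbT addnC; congr (_ + _)%N.
  apply: eq_card => l; rewrite !inE ltnS [(l <= j)%N]leq_eqVlt -[l == j :> nat]/(l == Ordinal ltj).
  by case: eqP => [->|_] //=; rewrite ltnn andbF.
have uptoE (Y : {set 'I_n}) : upto Y n = Y by apply/setP=> l; rewrite !inE ltn_ord andbT.
have small (Y : {set 'I_n}) : (`|Posz #|Y| | < 2 ^ W)%N.
  by rewrite absz_nat; apply: leq_ltn_trans (ltnW ltSnW); rewrite -[leqRHS]card_ord max_card.
apply: (wp_for (Inv := fun j s => [/\ isset s X,
  forall l : 'I_n, (l < j)%N -> s 1%N l = (l \in inside a b X)%:Z,
  s 9%N 0%N = #|upto X j| & s 10%N 0%N = #|upto (inside a b X) j|])).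
- by split=> //; rewrite upto0 cards0.
- move=> j s1 ltj [sX1 s11 s19 s110] s13; pose jj := Ordinal ltj.
  apply: wp_then; apply: (wp_put_bool (i' := j) (c := true)) => //; apply: wp_then.
  apply: (wp_for (Inv := fun i s => [/\ isset s X, s 3%N 0%N = Posz jj,
    forall l : 'I_n, (l < j)%N -> s 1%N l = (l \in inside a b X)%:Z,
    s 1%N j = (below (a jj) X i && below (b jj) X i)%:Z &
    s 9%N 0%N = #|upto X j| /\ s 10%N 0%N = #|upto (inside a b X) j|])).
  + have b0 e : below e X 0 by apply/forallP.
    split=> //; rewrite /upd /= ?b0 ?eqxx // => l ltl.
    by rewrite (ltn_eqF ltl) s11.
  + move=> i s2 lti [sX2 s23 s21 s2j s29] s24.
    apply: (wp_put_bool (i' := j) (c := below (a jj) X i.+1 && below (b jj) X i.+1)) => //.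
      rewrite below2S; apply: seval_and; first by rewrite /= s23.
      apply/seval_not/seval_and; apply: seval_not; last by rewrite /= s24 (sX2 (Ordinal lti)).
      apply: seval_and; rewrite seval_eq.
        by rewrite (seval_a (j := jj) (i := Ordinal lti)) ?eqz_nat.
      by rewrite (seval_b (j := jj) (i := Ordinal lti)) ?eqz_nat.
    split=> //; rewrite /upd /= ?eqxx // => l ltl.
    by rewrite (ltn_eqF ltl) s21.
  move=> s2 [sX2 s23 s21 s2j [s29 s210]]; rewrite !below_full in s2j.
  apply: wp_then; apply: (wp_put 0 #|upto X j.+1|) => //.
    by rewrite /= s29 s23 /= (sX2 jj) uptoS -PoszD.
  apply: (wp_put 0 #|upto (inside a b X) j.+1|) => //.
    by rewrite /= /upd /= s210 s23 /= s2j uptoS inE -PoszD.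
  split=> // l; rewrite ltnS leq_eqVlt => /orP[/eqP E|]; last exact: s21.
  by rewrite (_ : l = jj); [rewrite /upd /= s2j inE|apply: val_inj].
- by move=> s1 [sX1 s11 s19 s110]; split=> //; rewrite ?s19 ?s110 ?uptoE // => j; apply: s11.
Qed.

End Closures.

(** * Testing independence *)

Section Independence.

Variables (n W : nat) (a b : 'I_n -> 'X_{1..n}).

Local Notation inp := (fun y : nat => input a b (Posz y)).
Local Notation wp := (wp n W inp).

Let E := max_exponent a b.
Let B := (n * (E * E)).+1.

Hypothesis bigW : (n.+1`! * B ^ n.+1 < 2 ^ W)%N.
Implicit Types (s : store) (Q C : store -> Prop) (X U : {set 'I_n}).

Definition dexp_nat (j c : nat) : int := inp (1 + (j * n + c))%N - inp (1 + ((n + j) * n + c))%N.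

Definition memn X (j : nat) : bool := if insub j is Some l then l \in inside a b X else false.

(* The rows with index outside [inside X] are replaced by unit vectors in n   *)
(* extra columns, so that the size of the Gram matrix does not depend on [X]. *)
Definition ext_row X (j c : nat) : int :=
  if (c < n)%N then (memn X j)%:Z * dexp_nat j c else ((j == (c - n)%N) && ~~ memn X j)%:Z.

Definition ext_gram X := gram (n + n) (ext_row X).

Lemma dexp_natE (j i : 'I_n) : dexp_nat j i = dexp a b j i.
Proof. by rewrite /dexp_nat input_a input_b. Qed.

Lemma memnE X (j : 'I_n) : memn X j = (j \in inside a b X).
Proof. by rewrite /memn valK. Qed.

Definition gram_term X j l c : int :=
  (memn X j)%:Z * (memn X l)%:Z * dexp_nat j c * dexp_nat l c.

Definition gram_part X j l i : int :=
  ((j == l) && ~~ memn X j)%:Z + \sum_(0 <= c < i) gram_term X j l c.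

Lemma gram_full X (j l : 'I_n) : gram_part X j l n = ext_gram X j l.
Proof.
rewrite /gram_part /ext_gram /gram big_split_ord /= [LHS]addrC; congr (_ + _).
  rewrite big_mkord; apply: eq_bigr => i _; rewrite /ext_row /= ltn_ord.
  by rewrite /gram_term; ring.
rewrite (bigD1 j) //= big1 => [|i /negbTE ij]; rewrite /ext_row ltnNge leq_addr /= addKn.
  rewrite eqxx addr0 [l == j :> nat]eq_sym andTb.
  by case: eqP => [->|]; case: (memn X _); rewrite ?mulr0 ?mulr1.
by rewrite -[j == i :> nat]/(j == i) eq_sym ij mul0r.
Qed.

(** The unit vectors live in columns where the rows inside [X] vanish, so adding them creates no
    relation and destroys none. *)
Lemma lead_indep X : (lead (ext_gram X) n != 0) = indep a b X.
Proof.
apply/idP/idP=> [D0|iX].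
  apply/indepP=> w w0 wB; apply/eqP; apply: contraNT D0 => wn0; apply/eqP.
  apply/lead_gram_eq0P; exists w => //; apply/rowP=> c; rewrite [RHS]mxE mxE.
  have [ltc|lec] := ltnP c n.
    have /rowP/(_ (Ordinal ltc)) := wB; rewrite [RHS]mxE => H; rewrite -[RHS]H mxE.
    apply: eq_bigr => j _; rewrite BratE mxE /ext_row ltc memnE rmorphM /= -dexp_natE.
    by case: (boolP (j \in _)) => [_|/w0 ->]; rewrite ?mul1r ?mul0r.
  rewrite big1 // => j _; rewrite mxE /ext_row ltnNge lec /= memnE.
  by case: (boolP (j \in _)) => [_|/w0 ->]; rewrite ?andbF ?mulr0 ?mul0r.
apply/negP => /eqP/lead_gram_eq0P[w wn0 wX].
have w0 j : j \notin inside a b X -> w 0 j = 0.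
  move=> jX; have /rowP/(_ (rshift n j)) := wX; rewrite [RHS]mxE mxE => <-.
  rewrite (bigD1 j) //= big1 => [|i /negbTE ij]; rewrite mxE /ext_row /= ltnNge leq_addr /= addKn.
    by rewrite eqxx memnE jX mulr1 addr0.
  by rewrite -[i == j :> nat]/(i == j) ij mulr0.
case/eqP: wn0; apply: (indepP _ _ _ iX) => //.
apply/rowP=> i; have /rowP/(_ (lshift n i)) := wX; rewrite [in X in X -> _]mxE => H.
rewrite [RHS]mxE; move: H; rewrite [RHS]mxE => H; rewrite -[RHS]H mxE; apply: eq_bigr => j _.
rewrite BratE mxE /ext_row /= ltn_ord memnE rmorphM /= -dexp_natE.
by case: (boolP (j \in _)) => [_|/w0 ->]; rewrite ?mul1r ?mul0r.
Qed.

Lemma dexp_nat_bound (j i : 'I_n) : (`|dexp_nat j i| <= E)%N.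
Proof.
rewrite dexp_natE /dexp.
have le (e : nat) : (e <= maxn (a j i) (b j i))%N -> (e <= E)%N.
  move=> le1; apply: leq_trans le1 _; rewrite /E /max_exponent.
  apply: leq_trans (leq_bigmax (F := fun j => \max_(i < n) maxn (a j i) (b j i)) j).
  exact: (leq_bigmax (F := fun i => maxn (a j i) (b j i))).
by have := le _ (leq_maxl _ _); have := le _ (leq_maxr _ _); lia.
Qed.

Lemma leq_bool_mul (c : bool) x : (c * x <= x)%N. Proof. by case: c; rewrite ?mul1n. Qed.

Lemma gram_part_bound X (j l : 'I_n) i : (i <= n)%N -> (`|gram_part X j l i| <= B)%N.
Proof.
move=> lein; apply: (@leq_trans (i * (E * E)).+1); last by rewrite ltnS leq_mul2r lein orbT.
elim: i lein => [|i IH] ltin.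
  by rewrite /gram_part big_geq // addr0 absz_nat leq_b1.
have {IH} := IH (ltnW ltin); rewrite /gram_part big_nat_recr //= addrA.
rewrite -/(gram_part X j l i) => IH.
have tri (x y : int) : (absz (x + y)%R <= absz x + absz y)%N by lia.
apply: leq_trans (tri _ _) _.
rewrite mulSn -addnS addnC leq_add //.
rewrite /gram_term !abszM !absz_nat -!mulnA.
have := dexp_nat_bound j (Ordinal ltin); have := dexp_nat_bound l (Ordinal ltin).
move=> bl bj; apply: leq_trans (leq_mul bj bl).
by do 2?apply: leq_trans (leq_bool_mul _ _) _.
Qed.

(** The bordered minor has order [k.+1], hence [n.+1] in [bigW]. In [B], a scalar product of
    exponent rows accounts for [n * (E * E)] and a unit vector for 1. *)
Lemma minor_bound X k (j l : 'I_n) : (k <= n)%N ->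
  (`|minor (ext_gram X) k j l| < 2 ^ W)%N.
Proof.
move=> lekn; apply: leq_ltn_trans bigW.
have gB (x y : nat) : (x < n)%N -> (y < n)%N -> (`|ext_gram X x y| <= B)%N.
  move=> ltx lty; have := gram_part_bound X (Ordinal ltx) (Ordinal lty) (leqnn n).
  by rewrite gram_full.
apply: leq_trans (ndet_bound (B := B) _) _.
  move=> x y ltx lty; have lt (z : nat) (i : 'I_n) : ((if (z < k)%N then z else i) < n)%N.
    by case: ifP => // ltz; apply: leq_trans lekn.
  exact: gB.
rewrite leq_mul ?leq_pexp2l //; have := fact_gt0 n.+1.
by rewrite (fact_split (lekn : k.+1 <= n.+1)%N) muln_gt0 => /andP[_]; apply: leq_pmulr.
Qed.

Lemma ltSnW : (n.+1 < 2 ^ W)%N.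
Proof.
apply: leq_ltn_trans bigW; apply: leq_trans (fact_geq _) _.
by rewrite leq_pmulr // expn_gt0.
Qed.

(** Common rule for the double loops that fill a table in array 2. [C] may depend on the entries at
    addresses outside [ad], as it does for the preceding elimination level. *)
Lemma wp_fill body (ad : 'I_n -> 'I_n -> nat) (v : 'I_n -> 'I_n -> int) C s :
  (forall k, writes k body -> (k == 2) || (k == 4)) ->
  (forall s s', (forall k, k \notin [:: 2; 3; 4; 12] -> s' k = s k) ->
     (forall x, (forall j l, x <> ad j l) -> s' 2%N x = s 2%N x) -> C s -> C s') ->
  (forall j l j' l', ad j l = ad j' l' -> j = j' /\ l = l') ->
  (forall s (j l : 'I_n), C s -> s 3%N 0%N = Posz j -> s 12%N 0%N = Posz l ->
     wp body (fun s' => forall x, s' 2%N x = if x == ad j l then v j l else s 2%N x) s) ->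
  C s ->
  wp (For 3 (For 12 body)) (fun s' => C s' /\ forall j l, s' 2%N (ad j l) = v j l) s.
Proof.
move=> Wb FC ad_inj Hb C0.
have noW k : k \notin [:: 2; 4] -> ~~ writes k body.
  by rewrite !inE; apply: contra => /Wb.
have FC3 s1 k x : (k == 3) || (k == 12) -> C s1 -> C (upd s1 k 0 x).
  move=> kk; apply: FC => [k'|y _]; last by case/orP: kk => /eqP->.
  by rewrite !inE !negb_or => /and4P[_ k3 _ k12]; apply: upd_neq; apply/negbTE;
     case/orP: kk => /eqP->.
apply: (wp_for (Inv := fun i s => C s /\
   forall j l : 'I_n, (j < i)%N -> s 2%N (ad j l) = v j l)).
- by split=> //; apply: FC3.
- move=> i s1 lti [C1 v1] s1i; pose ii := Ordinal lti.
  apply: (wp_for (Inv := fun i' s => [/\ C s, s 3%N 0%N = Posz ii &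
    forall j l : 'I_n, (j < i)%N || (j == ii) && (l < i')%N -> s 2%N (ad j l) = v j l])).
  + by split=> [||j l]; [apply: FC3|by []|rewrite andbF orbF; apply: v1].
  + move=> i' s2 lti' [C2 s2i v2] s2i'; pose ll := Ordinal lti'.
    apply: wp_framed (Hb s2 ii ll C2 s2i s2i') _ => s3 H3 F3.
    have C3 : C s3.
      apply: FC C2 => [k|x xad]; first by rewrite !inE !negb_or => /and4P[k2 k3 k4 k12];
        rewrite F3 // noW // !inE negb_or k2.
      by rewrite H3; case: eqP => // /xad.
    split; [exact: FC3|by rewrite -[LHS]/(s3 3%N 0%N) F3 // noW|].
    move=> j l H; rewrite -[LHS]/(s3 2%N (ad j l)) H3.
    case: eqP => [/ad_inj[-> ->] //|ne]; apply: v2.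
    case/orP: H => [->//|/andP[/eqP ej]]; rewrite ltnS leq_eqVlt => /orP[/eqP el|->].
      by case: ne; rewrite ej (_ : l = ll) //; apply: val_inj.
    by rewrite ej eqxx orbT.
  move=> s2 [C2 s2i v2]; split; first exact: FC3.
  move=> j l; rewrite ltnS leq_eqVlt => H; apply: v2.
  by rewrite ltn_ord andbT orbC.
- by move=> s' [C' v']; split=> // j l; apply: v'.
Qed.

Definition gram_entry : sx := scal 3 *e num +e scal 12.

Definition gram_prog : prog :=
  For 3 (For 12
    (Put 2 gram_entry ((scal 3 ==e scal 12) *e notx (SA 1 (scal 3))) ;;
     For 4 (Put 2 gram_entry
       (SA 2 gram_entry +e
        SA 1 (scal 3) *e SA 1 (scal 12) *e
        (in_a (scal 3) -e in_b (scal 3)) *e (in_a (scal 12) -e in_b (scal 12)))))).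

Lemma gram_part_small i X (j l : 'I_n) : (i <= n)%N -> (`|gram_part X j l i| < 2 ^ W)%N.
Proof.
move=> lei; apply: leq_ltn_trans (gram_part_bound X j l lei) _.
apply: leq_ltn_trans bigW; apply: leq_trans (leq_pmull _ (fact_gt0 _)).
by rewrite expnS leq_pmulr // expn_gt0.
Qed.

Lemma wp_gram X s : (forall j : 'I_n, s 1%N j = (j \in inside a b X)%:Z) ->
  wp gram_prog (fun s' => forall j l : 'I_n, s' 2%N (j * n + l)%N = ext_gram X j l) s.
Proof.
move=> s1.
pose C s := forall j : 'I_n, s 1%N j = (memn X j)%:Z.
have C0 : C s by move=> j; rewrite memnE s1.
apply: wp_mono (wp_fill (ad := fun j l => (j * n + l)%N) (v := ext_gram X) (C := C) _ _ _ _ C0).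
- by move=> s' [].
- by move=> k /or3P[] /eqnP->.
- by move=> s2 s3 F _ H j; rewrite F.
- by move=> j l j' l' /eqP; rewrite eq_idx => /andP[/eqP/val_inj-> /eqP->].
move=> {s1 C0} {}s j l C0 s3 s12.
have ad s' : s' 3%N = s 3%N -> s' 12%N = s 12%N ->
    seval inp s' gram_entry = (j * n + l)%N.
  by move=> E1 E2; rewrite /= E1 E2 s3 s12 -PoszM -PoszD.
apply: wp_then; apply: (wp_put (j * n + l)%N (gram_part X j l 0)) => //.
- exact: ad.
- rewrite /gram_part big_geq // addr0; apply: seval_and.
    by rewrite seval_eq /= s3 s12 eqz_nat.
  by apply: seval_not; rewrite /= s3 C0.
- exact: gram_part_small.
apply: (wp_for (Inv := fun i s' => [/\ s' 3%N = s 3%N, s' 12%N = s 12%N, C s' &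
  forall x, s' 2%N x = if x == (j * n + l)%N then gram_part X j l i else s 2%N x])) => //.
- move=> i s1' lti [e3 e12 C1 e2] s1i; pose ii := Ordinal lti.
  apply: (wp_put (j * n + l)%N (gram_part X j l i.+1)).
  + exact: ad.
  + rewrite !(seval_add, seval_mul, seval_sub).
    have E3 : seval inp s1' (scal 3) = j by rewrite /= e3.
    have E12 : seval inp s1' (scal 12) = l by rewrite /= e12.
    rewrite (seval_a (j := j) (i := ii)) // (seval_b (j := j) (i := ii)) //.
    rewrite (seval_a (j := l) (i := ii)) // (seval_b (j := l) (i := ii)) //.
    rewrite -[seval inp s1' (SA 2 _)]/(s1' 2%N (absz (seval inp s1' gram_entry))) ad // absz_nat.
    rewrite -[seval inp s1' (SA 1 (scal 3))]/(s1' 1%N (absz (seval inp s1' (scal 3)))) E3 absz_nat.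
    rewrite -[seval inp s1' (SA 1 (scal 12))]/(s1' 1%N (absz (seval inp s1' (scal 12)))) E12 absz_nat.
    rewrite e2 eqxx !C1 /gram_part big_nat_recr //= addrA; congr (_ + _).
    by rewrite /gram_term (dexp_natE j ii) (dexp_natE l ii).
  + exact: gram_part_small.
  split=> // x; rewrite -[LHS]/(if x == (j * n + l)%N then _ else _).
  by rewrite e2; case: eqP.
- by move=> s' [_ _ _ e2] x; rewrite e2 gram_full.
Qed.

Definition level (k j l : sx) : sx := SA 2 ((k *e num +e j) *e num +e l).

(** Level [k] is the block of array 2 starting at [k * n * n]. During round [k] scalar 11 is the
    divisor [lead k]; the pivot of that level is [lead k.+1], kept for the next round. *)
Definition bareiss : prog :=
  Put 11 (SC 0) (SC 1) ;;
  For 13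
    (For 3 (For 12
      (Put 2 (((scal 13 +e SC 1) *e num +e scal 3) *e num +e scal 12)
        (SOp OQuo
          (level (scal 13) (scal 13) (scal 13) *e level (scal 13) (scal 3) (scal 12) -e
           level (scal 13) (scal 3) (scal 13) *e level (scal 13) (scal 13) (scal 12))
          (scal 11)))) ;;
     Put 11 (SC 0) (level (scal 13) (scal 13) (scal 13))).

Lemma wp_bareiss X s : (forall j l : 'I_n, s 2%N (j * n + l)%N = ext_gram X j l) ->
  wp bareiss (fun s' => s' 11%N 0%N = lead (ext_gram X) n) s.
Proof.
move=> s2; set G := ext_gram X.
apply: wp_then; apply: (wp_put 0 1) => //.
  by apply: leq_ltn_trans ltSnW.
pose C k s := [/\ s 13%N 0%N = Posz k, s 11%N 0%N = lead G k &
  forall j l : 'I_n, s 2%N ((k * n + j) * n + l)%N = minor G k j l].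
apply: (wp_for (Inv := fun k s => [/\ s 11%N 0%N = lead G k &
  forall j l : 'I_n, s 2%N ((k * n + j) * n + l)%N = minor G k j l])).
- by split=> [|j l]; rewrite /upd /= ?lead0 // minor0 mul0n add0n s2.
- move=> k s1 ltk [s11 sM] s13; pose kk := Ordinal ltk.
  have C1 : C k s1 by split.
  have lev s' (x y : sx) (j l : 'I_n) : C k s' ->
      seval inp s' x = Posz j -> seval inp s' y = Posz l ->
      seval inp s' (level (scal 13) x y) = minor G k j l.
    move=> [e13 e11 eM] ex ey; rewrite -eM.
    rewrite -[LHS]/(s' 2%N (absz ((s' 13%N 0%N * n + seval inp s' x) * n + seval inp s' y))).
    by rewrite e13 ex ey -!(PoszM, PoszD).
  apply: wp_then.
  apply: wp_mono (wp_fill (ad := fun j l => ((k.+1 * n + j) * n + l)%N)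
    (v := fun j l => minor G k.+1 j l) (C := C k) _ _ _ _ C1).
  + move=> s' [C' v']; have [e13 e11 eM] := C'.
    apply: (wp_put 0 (lead G k.+1)) => //.
    * by rewrite (lev _ _ _ kk kk) // -minor_lead.
    * by rewrite -minor_lead -[k]/(val kk); apply: minor_bound; apply: ltnW.
  + by move=> k' /eqnP->.
  + move=> s3 s4 F F2 [e13 e11 eM]; split=> [||j l]; [by rewrite F|by rewrite F|].
    rewrite F2 // => j' l' /eqP; rewrite eq_idx eq_idx.
    by case/andP=> /andP[/eqP]; lia.
  + move=> j l j' l' /eqP; rewrite !eq_idx => /andP[/andP[_ /eqP->] /eqP->].
    by [].
  + move=> s3 j l C3 s33 s312; have [e13 e11 eM] := C3.
    apply: (wp_put ((k.+1 * n + j) * n + l)%N (minor G k.+1 j l)).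
    * rewrite -[LHS]/(((s3 13%N 0%N + 1) * n + s3 3%N 0%N) * n + s3 12%N 0%N).
      by rewrite e13 s33 s312 -!(PoszM, PoszD) addn1.
    * rewrite seval_quo !(seval_sub, seval_mul) (lev _ _ _ kk kk) // (lev _ _ _ j l) //.
      rewrite (lev _ _ _ j kk) // (lev _ _ _ kk l) // -[seval inp s3 (scal 11)]/(s3 11%N 0%N) e11.
      by rewrite /G /ext_gram bareiss_step.
    * exact: minor_bound.
    by [].
- by move=> s' [].
Qed.

End Independence.

(** * The theorem *)

Definition block : prog := closure ;; sizes ;; gram_prog ;; bareiss.

(** The test of [full_principal]: the closure of the empty set must be independent, and that of each
    singleton dependent or full. *)
Definition gci_prog : prog :=
  Put 6 (SC 0) (SC 1) ;;
  For 4 (Put 0 (scal 4) (SC 0)) ;;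
  block ;;
  Test (scal 11 ==e SC 0) (Put 6 (SC 0) (SC 0)) Done ;;
  For 14
    (For 4 (Put 0 (scal 4) (scal 4 ==e scal 14)) ;;
     block ;;
     Test (scal 11 ==e SC 0) Done
       (Test (scal 9 ==e scal 10) Done (Put 6 (SC 0) (SC 0)))).

Section GciProgram.

Variables (n W : nat) (a b : 'I_n -> 'X_{1..n}).

Local Notation inp := (fun y : nat => input a b (Posz y)).
Local Notation wp := (wp n W inp).

Hypothesis bigW :
  (n.+1`! * (n * (max_exponent a b * max_exponent a b)).+1 ^ n.+1 < 2 ^ W)%N.

Lemma wp_block s X0 : isset s X0 ->
  wp block (fun s' => exists X, [/\ generated a b X0 X,
    (s' 11%N 0%N == 0) = ~~ indep a b X &
    (s' 9%N 0%N == s' 10%N 0%N) = (#|inside a b X| == #|X|)]) s.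
Proof.
move=> sX0; have SW := ltSnW bigW.
apply: wp_then; apply: wp_mono (wp_closure a b SW sX0) => s1 [X sX gX].
apply: wp_then; apply: wp_mono (wp_sizes a b SW sX) => s2 [_ s21 s29 s210].
apply: wp_then; apply: wp_framed (wp_gram bigW s21) _ => s3 s3G F3.
apply: wp_framed (wp_bareiss bigW s3G) _ => s4 s411 F4.
exists X; split=> //.
  by rewrite s411 -lead_indep negbK.
by rewrite !F4 // !F3 // s29 s210 eqz_nat eq_sym.
Qed.

Lemma wp_init_set s (X0 : {set 'I_n}) e :
  (forall s' (i : 'I_n), s' 4%N 0%N = Posz i -> (forall k, (4 < k)%N -> s' k = s k) ->
     seval inp s' e = (i \in X0)%:Z) ->
  wp (For 4 (Put 0 (scal 4) e)) (fun s' => isset s' X0) s.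
Proof.
move=> He; have SW := ltSnW bigW.
apply: (wp_for (Inv := fun i s' => (forall k, (4 < k)%N -> s' k = s k) /\
  forall l : 'I_n, (l < i)%N -> s' 0%N l = (l \in X0)%:Z)).
- by split=> // k ltk; apply: upd_neq; apply/eqP; lia.
- move=> i s1 lti [F1 s10] s14; pose l := Ordinal lti.
  apply: (wp_put_bool SW (i' := i) (c := l \in X0)) => //; first exact: (He _ l).
  split=> [k ltk|l'].
    by rewrite !upd_neq ?F1 //; apply/eqP; lia.
  rewrite ltnS leq_eqVlt /upd /=; case: eqP => [E _|_ /= lt]; last exact: s10.
  by rewrite (_ : l' = l) //; apply: val_inj.
- by move=> s' [_ H] l; apply: H.
Qed.

Lemma wp_gci_prog :
  wp gci_prog (fun s => (`|s 6%N 0%N| < 2 ^ W)%N /\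
     (s 6%N 0%N != 0 <->
        (exists2 S, closed a b S & indep a b S) /\
        (forall S, closed a b S -> indep a b S -> #|inside a b S| = #|S|)))
    (fun _ _ => 0).
Proof.
have SW := ltSnW bigW.
apply: wp_then; apply: (wp_put_bool SW (i' := 0%N) (c := true)) => //.
apply: wp_then; apply: wp_framed (wp_init_set (X0 := set0) _) _.
  by move=> s' i _ _; rewrite inE.
move=> s1 sX F1; apply: wp_then; apply: wp_framed (wp_block sX) _.
move=> s2 [C0 [gC0 s211 _]] F2; apply: wp_then.
have s26 : s2 6%N 0%N = 1 by rewrite F2 // F1.
pose Inv (r : nat) (s : store) := exists C : 'I_n -> {set 'I_n},
  (forall i : 'I_n, (i < r)%N -> generated a b [set i] (C i)) /\
  s 6%N 0%N = (indep a b C0 && [forall i : 'I_n, (i < r)%N ==>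
     indep a b (C i) ==> (#|inside a b (C i)| == #|C i|)])%:Z.
have finish s : Inv n s -> (`|s 6%N 0%N| < 2 ^ W)%N /\
     (s 6%N 0%N != 0 <->
        (exists2 S, closed a b S & indep a b S) /\
        (forall S, closed a b S -> indep a b S -> #|inside a b S| = #|S|)).
  move=> [C [gC ->]]; split; first exact: (small_bool SW).
  rewrite (full_principal gC0 (C := C)) => [|i]; last exact: gC.
  have -> (c : bool) : (c%:Z != 0) = c by case: c.
  split=> [/andP[i0 /forallP H]|[i0 H]].
    by split=> // i iC; apply/eqP; have := H i; rewrite ltn_ord iC.
  rewrite i0; apply/forallP=> i; rewrite ltn_ord /=; apply/implyP=> iC.
  by apply/eqP; apply: H.
have start : wp (Test (scal 11 ==e SC 0) (Put 6 (SC 0) (SC 0)) Done) (Inv 0%N) s2.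
  have E : seval inp s2 (scal 11 ==e SC 0) = (~~ indep a b C0)%:Z by rewrite -s211.
  have all0 (C : 'I_n -> {set 'I_n}) : [forall i : 'I_n, (i < 0)%N ==>
     indep a b (C i) ==> (#|inside a b (C i)| == #|C i|)] by apply/forallP.
  apply: wp_test; rewrite E; case: (boolP (indep a b C0)) => // iC0 _.
    apply: (wp_put_bool SW (i' := 0%N) (c := false)) => //.
    by exists (fun=> set0); rewrite (negbTE iC0).
  by exists (fun=> set0); rewrite iC0 all0.
apply: wp_mono start => s3 inv3.
apply: (wp_for (Inv := Inv)) => //.
move=> r s4 ltr [C [gC s46]] s4r; pose l := Ordinal ltr.
apply: wp_then; apply: wp_framed (wp_init_set (X0 := [set l]) _) _.
  move=> s' i s'4 F; rewrite seval_eq -[seval inp s' (scal 4)]/(s' 4%N 0%N).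
  by rewrite -[seval inp s' (scal 14)]/(s' 14%N 0%N) s'4 F // s4r eqz_nat inE.
move=> s5 sX5 F5; apply: wp_then; apply: wp_framed (wp_block sX5) _.
move=> s6 [X [gX s611 s69]] F6.
pose C' i := if i == l then X else C i.
have gC' (i : 'I_n) : (i < r.+1)%N -> generated a b [set i] (C' i).
  rewrite ltnS leq_eqVlt -[i == r :> nat]/(i == l) /C'.
  by case: eqP => [-> //|_] /=; apply: gC.
have allS : [forall i : 'I_n, (i < r.+1)%N ==>
     indep a b (C' i) ==> (#|inside a b (C' i)| == #|C' i|)] =
  [forall i : 'I_n, (i < r)%N ==> indep a b (C i) ==> (#|inside a b (C i)| == #|C i|)] &&
  (indep a b X ==> (#|inside a b X| == #|X|)).
  apply/forallP/andP=> [H|[/forallP H HX] i].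
    split; last by have := H l; rewrite ltnSn /C' eqxx.
    apply/forallP=> i; apply/implyP=> lt; have := H i; rewrite ltnS ltnW // /C'.
    by case: eqP => // E; rewrite E ltnn in lt.
  rewrite ltnS leq_eqVlt -[i == r :> nat]/(i == l) /C'.
  by case: eqP => [_|_] //=; apply: H.
have s66 : s6 6%N 0%N = s4 6%N 0%N by rewrite F6 // F5.
have keep : indep a b X ==> (#|inside a b X| == #|X|) ->
    Inv r.+1 (upd s6 14 0 r.+1).
  move=> HX; exists C'; split; first exact: gC'.
  by rewrite allS HX andbT -s46 -s66.
have E11 : seval inp s6 (scal 11 ==e SC 0) = (~~ indep a b X)%:Z by rewrite -s611.
have E9 : seval inp s6 (scal 9 ==e scal 10) = (#|inside a b X| == #|X|)%:Z by rewrite -s69.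
apply: wp_test; rewrite E11; case: (boolP (indep a b X)) => // iX _.
  by apply: keep; rewrite (negbTE iX).
apply: wp_test; rewrite E9; case: (boolP (#|inside a b X| == #|X|)) => // cX _.
  by apply: keep; rewrite cX implybT.
apply: (wp_put_bool SW (i' := 0%N) (c := false)) => //.
by exists C'; split; [exact: gC'|rewrite allS iX (negbTE cX) !andbF].
Qed.

End GciProgram.

(** The factorial is at most [2 ^ (n * n.+1)] and the base at most [2 ^ (n + 2 * L)]; with
    [x = n + L] the product is at most [2 ^ (2 * x * x)]. *)
Lemma minors_fit n E : (0 < n)%N ->
  (n.+1`! * (n * (E * E)).+1 ^ n.+1 < 2 ^ (3 * (n + bits E) ^ 4))%N.
Proof.
move=> n0; set L := bits E.
have ltE : (E < 2 ^ L)%N by rewrite /L /bits trunc_log_ltn.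
have ltn2 : (n < 2 ^ n)%N by rewrite ltn_expl.
have L0 : (0 < L)%N by [].
have le1 : (n.+1`! <= 2 ^ (n * n.+1))%N.
  rewrite expnM; apply: (@leq_trans (n.+1 ^ n.+1)); last by rewrite leq_exp2r.
  have fact_le m : (m <= n.+1)%N -> (m`! <= n.+1 ^ m)%N.
    elim: m => // m IH ltm; rewrite factS expnS leq_mul // IH //; exact: ltnW.
  exact: fact_le.
have le2 : ((n * (E * E)).+1 <= 2 ^ (n + 2 * L))%N.
  rewrite expnD mul2n -addnn expnD.
  apply: leq_trans (leq_mul ltn2 (leq_mul ltE ltE)); nia.
apply: (@leq_ltn_trans (2 ^ (n * n.+1) * 2 ^ ((n + 2 * L) * n.+1))).
  by rewrite leq_mul // expnM leq_exp2r.
rewrite -expnD ltn_exp2l // -mulnDl.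
set x := (n + L)%N; have ltx : (n < x)%N by rewrite /x; lia.
have -> : (n + (n + 2 * L) = 2 * x)%N by rewrite /x; lia.
apply: (@leq_ltn_trans (2 * x * x)); first by rewrite leq_mul2l ltx orbT.
rewrite !expnS expn0 muln1.
have : (x * x * 1 <= x * x * (x * x))%N by rewrite leq_mul2l muln_gt0 (leq_ltn_trans _ ltx) ?orbT.
have : (0 < x * x)%N by rewrite muln_gt0 (leq_ltn_trans _ ltx).
by rewrite !mulnA; lia.
Qed.

Theorem theorem2p12 (k : fieldType) (kbar : closedFieldType)
    (iota : {rmorphism k -> kbar})
    (char0 : [pchar k] =i pred0)
    (kbar_algebraic : forall x : kbar, algebraicOver iota x) :
  (exists (p : cmd) (C d : nat),
     forall (n : nat) (a b : 'I_n -> 'X_{1..n}),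
       (0 < n)%N -> (forall j, a j != b j) ->
       decides p (input a b)
         (C * n ^ d)%N
         (C * (n + bits (max_exponent a b)) ^ d)%N
         (gci iota a b))
  /\
  (exists (p : cmd) (C : nat),
     forall (n : nat) (a b : 'I_n -> 'X_{1..n}),
       (0 < n)%N -> (forall j, a j != b j) ->
       \det (exponent_matrix a b) != 0 ->
       forall c : {ffun 'I_n -> k}, torus c ->
       decides p (input a b)
         (C * n ^ 2)%N
         (C * bits (n + max_exponent a b))%N
         (complete_intersection iota a b c)).
Proof.
have time_bound p d n C : (0 < n)%N -> deg p = d -> (coef p + 4 <= C)%N ->
    (time n p + 4 <= C * n ^ d)%N.
  move=> n0 <- leC; apply: (@leq_trans ((coef p + 4) * n ^ deg p)).
    by rewrite mulnDl leq_add ?time_le // leq_pmulr // expn_gt0 n0.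
  by rewrite leq_mul2r leC orbT.
split.
(* The 7 leaves room for the 4 steps of the final copy and for the factor 3 of [minors_fit]; 4 is
   the nesting depth of [gci_prog]. *)
- exists (answer gci_prog 6), (coef gci_prog + 7)%N, 4%N => n a b n0 _.
  set W := (_ * (_ + _) ^ 4)%N.
  have bigW : (n.+1`! * (n * (max_exponent a b * max_exponent a b)).+1 ^ n.+1 < 2 ^ W)%N.
    apply: leq_trans (minors_fit _ n0) _; rewrite leq_exp2l // /W leq_mul2r.
    by rewrite (leq_trans _ (leq_addl _ _)) ?orbT.
  apply: decides_answer => //.
  + exact: ltnW (ltSnW bigW).
  + by apply: time_bound => //; rewrite leq_add2l.
  apply: wp_mono (wp_gci_prog bigW) => s [lt E]; split=> //.
  by rewrite E; apply: iff_sym; apply: gciP.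
- exists (answer complete_intersection_prog 6), (coef complete_intersection_prog + 7)%N => n a b n0 _ d0 c tc.
  have iT := det_indep d0.
  have C3 : (3 <= coef complete_intersection_prog + 7)%N by apply: leq_trans (leq_addl _ _).
  have smallW := small_bits a b n0 C3.
  apply: decides_answer => //.
  + by apply: leq_ltn_trans smallW; lia.
  + by apply: time_bound => //; rewrite leq_add2l.
  apply: wp_mono (wp_complete_intersection_prog smallW iT) => s [lt E]; split=> //.
  by rewrite E; apply: iff_sym; apply: complete_intersection_indepP.
Qed.
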